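(* Let $(X,J)$ be an almost complex manifold and let $(X',J')$ be an almost complex submanifold of $(X,J)$ (that is, a submanifold $X'\subset X$ whose tangent spaces are $J$-invariant, with $J'=J|_{TX'}$). If $u:X\to[-\infty,\infty)$ is upper semi-continuous and $F(J)$-plurisubharmonic on $X$, then the restriction $u|_{X'}$ is $F(J')$-plurisubharmonic on $X'$.
   Context: All almost complex structures are $C^\infty$. On an almost complex manifold $(X,J)$ write $TX\otimes\mathbb{C}=T_{1,0}\oplus T_{0,1}$ for the $\pm i$-eigenspaces of $J$. Let $\partial,\bar\partial$ be the operators obtained from the exterior derivative $d$ on $(p,q)$-forms by projecting to the $(p+1,q)$- and $(p,q+1)$-components. For a real $C^2$ function $\varphi$ the complex hessian is the hermitian symmetric form on $T_{1,0}X$ given by $\mathcal{H}(\varphi)(V,W)=(\partial\bar\partial\varphi)(V,\overline W)$; equivalently, for local sections $V,W$ of $T_{1,0}X$, $\mathcal{H}(\varphi)(V,W)=\big(\tfrac12V\overline W+\tfrac12\overline WV-\tfrac i2J[V,\overline W]\big)\varphi$. At a point $x$ it depends only on the 2-jet of $\varphi$ at $x$. For an upper semi-continuous $u:X\to[-\infty,\infty)$, a test function for $u$ at $x$ is a function $\varphi$, $C^2$ near $x$, with $u-\varphi\le 0$ near $x$ and $u-\varphi=0$ at $x$. The function $u$ is $F(J)$-plurisubharmonic if $\mathcal{H}_x(\varphi)\ge0$ for every $x\in X$ and every test function $\varphi$ for $u$ at $x$. *)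

(* Defs.v *)
From HB Require Import structures.
From mathcomp Require Import all_boot all_order all_algebra.
From mathcomp Require Import all_classical all_reals all_analysis.
From mathcomp Require Import complex.

Set Implicit Arguments.
Unset Strict Implicit.
Unset Printing Implicit Defensive.

Import Order.TTheory GRing.Theory Num.Theory.
Import numFieldNormedType.Exports.

Local Open Scope classical_set_scope.
Local Open Scope ring_scope.

(* C^k on an open subset U of a finite-dimensional normed space V; there, it is
   enough to differentiate along constant directions. *)
Fixpoint Ck (R : realType) (V W : normedModType R) (k : nat) (U : set V)
    (f : V -> W) {struct k} : Prop :=
  if k is k'.+1 then
    (forall p, U p -> differentiable f p) /\ (forall v, Ck k' U ('D_v f))
  else {within U, continuous f}.

Definition Cinfty (R : realType) (V W : normedModType R) (U : set V)
  (f : V -> W) : Prop := forall k, Ck k U f.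

(* The map and its inverse are total functions; only their restrictions to the
   domain and to the codomain of the chart are meaningful. *)
Record chart (R : realType) (X : topologicalType) (n : nat) := Chart {
  cdom : set X;
  cmap :> X -> 'rV[R]_n;
  cinv : 'rV[R]_n -> X;
  cdom_open : open cdom;
  ccod_open : open (cmap @` cdom);
  cmap_continuous : {within cdom, continuous cmap};
  cinv_continuous : {within cmap @` cdom, continuous cinv};
  cmapK : forall x, cdom x -> cinv (cmap x) = x
}.

Definition ccod (R : realType) (X : topologicalType) n (c : chart R X n) :
  set 'rV[R]_n := c @` cdom c.

Record smooth_manifold (R : realType) (X : topologicalType) (n : nat) :=
  SmoothManifold {
  manifold_hausdorff : hausdorff_space X;
  manifold_second_countable : @second_countable X;
  atlas : set (chart R X n);
  atlas_cover : forall x, exists2 c, atlas c & cdom c x;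
  atlas_smooth : forall c c', atlas c -> atlas c' ->
    Cinfty (c @` (cdom c `&` cdom c')) (c' \o cinv c)
}.

(* An almost complex structure is given by its matrix in each chart.  Tangent
   vectors are row vectors, so that matrices (in particular Jacobian matrices)
   act on the right. *)
Record almost_complex (R : realType) (X : topologicalType) (n : nat)
    (M : smooth_manifold R X n) := AlmostComplex {
  acmx :> chart R X n -> 'rV[R]_n -> 'M[R]_n;
  acmx_smooth : forall c, atlas M c -> Cinfty (ccod c) (acmx c);
  acmx_sqr : forall c p, atlas M c -> ccod c p ->
    acmx c p *m acmx c p = - 1%:M;
  acmx_compat : forall c c' p, atlas M c -> atlas M c' ->
    (c @` (cdom c `&` cdom c')) p ->
    acmx c p *m jacobian (c' \o cinv c) p =
    jacobian (c' \o cinv c) p *m acmx c' ((c' \o cinv c) p)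
}.

(* The inclusion of a subset A of X, read in a chart c' of A and a chart c
   of X. *)
Section Inclusion.
Context (R : realType) (X : topologicalType) (n m : nat) (A : set X).
Variables (c' : chart R A m) (c : chart R X n).

Definition incl : 'rV[R]_m -> 'rV[R]_n :=
  fun p => c (set_val (cinv c' p)).

Definition incl_dom : set 'rV[R]_m :=
  c' @` (cdom c' `&` [set a | cdom c (set_val a)]).
End Inclusion.

(* Since the type A carries the subspace topology, its inclusion into X is a
   topological embedding, and an immersion makes A an embedded submanifold. *)
Definition submanifold (R : realType) (X : topologicalType) (n m : nat)
    (A : set X) (M : smooth_manifold R X n) (M' : smooth_manifold R A m) :
    Prop :=
  forall c' c, atlas M' c' -> atlas M c ->
    Cinfty (incl_dom c' c) (incl c' c) /\
    (forall p, incl_dom c' c p -> row_free (jacobian (incl c' c) p)).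

(* The last condition says that J preserves the tangent spaces of A and
   restricts to J' on them. *)
Definition almost_complex_submanifold (R : realType) (X : topologicalType)
    (n m : nat) (A : set X) (M : smooth_manifold R X n)
    (J : almost_complex M) (M' : smooth_manifold R A m)
    (J' : almost_complex M') : Prop :=
  submanifold M M' /\
  forall c' c p, atlas M' c' -> atlas M c -> incl_dom c' c p ->
    J' c' p *m jacobian (incl c' c) p =
    jacobian (incl c' c) p *m J c (incl c' c p).

Definition Cx (R : realType) : numClosedFieldType := R[i].

(* Complex vectors are row vectors; the value of a 1-form with coefficients the
   column a on V is V *m a, and the value of a 2-form with matrix w on V, W is
   V *m w *m W^T. *)
Section Coordinates.
Context (R : realType) (n : nat).
Implicit Types (J : 'rV[R]_n -> 'M[R]_n) (f : 'rV[R]_n -> R) (p : 'rV[R]_n).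

Definition cmx (m : nat) (B : 'M[R]_(m, n)) : 'M[Cx R]_(m, n) :=
  map_mx (real_complex R : R -> Cx R) B.

Definition proj10 (j : 'M[R]_n) : 'M[Cx R]_n :=
  2^-1 *: (1%:M - 'i *: cmx j).

Definition proj01 (j : 'M[R]_n) : 'M[Cx R]_n :=
  2^-1 *: (1%:M + 'i *: cmx j).

Definition T10 (j : 'M[R]_n) (V : 'rV[Cx R]_n) : Prop :=
  V *m cmx j = 'i *: V.

Definition partial (W : normedModType R) (k : 'I_n) (f : 'rV[R]_n -> W) p : W :=
  'D_(delta_mx 0 k) f p.

Definition cpartial (k : 'I_n) (f : 'rV[R]_n -> Cx R) p : Cx R :=
  Complex (partial k (fun q => complex.Re (f q)) p)
          (partial k (fun q => complex.Im (f q)) p).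

Definition d0 f p : 'cV[Cx R]_n := \col_k (real_complex R (partial k f p) : Cx R).

Definition d1 (a : 'rV[R]_n -> 'cV[Cx R]_n) p : 'M[Cx R]_n :=
  \matrix_(j, k) (cpartial j (fun q => a q k 0) p -
                  cpartial k (fun q => a q j 0) p).

(* The (0,1)-component of a 1-form is obtained by precomposing it with the
   projection of the complexified tangent space onto T_{0,1}. *)
Definition dbar J f p : 'cV[Cx R]_n := proj01 (J p) *m d0 f p.

(* The image of a (0,1)-form a under the operator del is the (1,1)-component of
   d a, and the (1,1)-component of a 2-form w is
   (V, W) |-> w(V_{1,0}, W_{0,1}) + w(V_{0,1}, W_{1,0}). *)
Definition del J (a : 'rV[R]_n -> 'cV[Cx R]_n) p : 'M[Cx R]_n :=
  proj10 (J p) *m d1 a p *m (proj01 (J p))^T +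
  proj01 (J p) *m d1 a p *m (proj10 (J p))^T.

Definition hessian J f p (V W : 'rV[Cx R]_n) : Cx R :=
  (V *m del J (dbar J f) p *m (map_mx Num.conj W)^T) 0 0.
End Coordinates.

Section Plurisubharmonic.
Context (R : realType) (X : topologicalType) (n : nat).
Variables (M : smooth_manifold R X n) (J : almost_complex M).

Definition C2_near (x : X) (phi : X -> R) : Prop :=
  exists U, open_nbhs x U /\
    forall c, atlas M c -> Ck 2 (c @` (cdom c `&` U)) (phi \o cinv c).

Definition test_function (u : X -> \bar R) (x : X) (phi : X -> R) : Prop :=
  [/\ C2_near x phi,
      \forall y \near x, (u y - (phi y)%:E <= 0)%E &
      (u x - (phi x)%:E = 0)%E].

(* In Cx R, 0 <= z means that z is real and nonnegative.  The hessian is a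
   tensor, so the condition does not depend on the chart c. *)
Definition hessian_ge0 (x : X) (phi : X -> R) : Prop :=
  forall c, atlas M c -> cdom c x ->
  forall V : 'rV[Cx R]_n, T10 (J c (c x)) V ->
    0 <= hessian (J c) (phi \o cinv c) (c x) V V.

Definition upper_semicontinuous (u : X -> \bar R) : Prop :=
  forall a : R, open [set x | (u x < a%:E)%E].

(* F(J)-plurisubharmonicity, including the standing assumption that u is an
   upper semicontinuous function with values in [-oo, +oo[. *)
Definition plurisubharmonic (u : X -> \bar R) : Prop :=
  [/\ (forall x, (u x < +oo)%E),
      upper_semicontinuous u &
      forall x phi, test_function u x phi -> hessian_ge0 x phi].
End Plurisubharmonic.

(* Main.v *)
Require Import Defs.
From mathcomp Require Import all_boot all_order all_algebra.
From mathcomp Require Import all_classical all_reals all_analysis.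
From mathcomp Require Import complex.
From mathcomp Require Import ring lra.

Set Implicit Arguments.
Unset Strict Implicit.
Unset Printing Implicit Defensive.

Import Order.TTheory GRing.Theory Num.Theory.
Import numFieldNormedType.Exports.

Local Open Scope classical_set_scope.
Local Open Scope ring_scope.

(* Read in charts, [X'] is the image of an immersion [f] with
   [J' Df = Df J(f)].  Let [phi] touch [u o f] from above at [p0].  Maximize
   [u(z) - phi(p) - |p - p0|^4 - k |z - f(p)|^2] over a compact neighbourhood of
   [(f(p0), p0)]; as [k] tends to infinity the maxima [(z, p)] tend to
   [(f(p0), p0)] and [k |z - f(p)|^2] tends to 0.  At such a maximum,
   [phi o r + k |x - f(r(x))|^2] (with the quartic term included in [phi]) is a
   test function for [u] at [z], where [r] is a local retraction onto the image
   of [f] with [r(z) = p].  Its complex hessian is nonnegative in the direction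
   [A = a Df(p)].  The part coming from [phi o r] tends to the hessian of [phi]
   at [p0] in the direction [a].  The error terms multiplying [k] are built from
   functions of [(z, p)] that vanish for [z = f(p)] because [f] is
   pseudo-holomorphic; being Lipschitz, they are [O(|z - f(p)|)], and they
   contribute at most [C k |z - f(p)|^2], which tends to 0. *)

(** * Calculus of maps of class C^k on open sets *)

Lemma near_eq_differentiable (R : realType) (V W : normedModType R)
    (f g : V -> W) (x : V) :
  (\near x, f x = g x) -> differentiable f x -> differentiable g x.
Proof.
move=> fg df; have [cdf ef] := (diff_locallyP _ _).1 df.
have eg : g \o shift x = cst (g x) + 'd f x +o_ 0 id.
  apply/eqaddoP => e e0.
  have /eqaddoP/(_ e e0) := ef.
  have fgx : \forall h \near (0 : V), f (h + x) = g (h + x).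
    by move: fg; rewrite (near_shift 0) subr0.
  apply: filter_app; apply: filterS fgx => h fgh.
  by rewrite /= !fctE /= /shift /= fgh (nbhs_singleton fg).
have dg := diff_unique cdf eg.
apply/diff_locallyP; split; first by rewrite dg.
by rewrite dg.
Qed.

Lemma Ck0P (R : realType) (V W : normedModType R) (U : set V) (f : V -> W) :
  open U -> Ck 0 U f <-> (forall p, U p -> {for p, continuous f}).
Proof.
move=> oU; rewrite /= continuous_open_subspace //; split=> h p.
  by move=> Up; apply: h; rewrite inE.
by rewrite inE; exact: h.
Qed.

Lemma CkS (R : realType) (V W : normedModType R) (k : nat) (U : set V)
    (f : V -> W) : open U -> Ck k.+1 U f -> Ck k U f.
Proof.
move=> oU; elim: k f => [|k IH] f [df Df].
  by apply/Ck0P => // p Up; exact/differentiable_continuous/df.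
by split=> // v; exact/IH/Df.
Qed.

Lemma Ck_subset (R : realType) (V W : normedModType R) (k : nat) (U U' : set V)
    (f : V -> W) : open U -> open U' -> U' `<=` U -> Ck k U f -> Ck k U' f.
Proof.
move=> oU oU' sU; elim: k f => [|k IH] f.
  by move=> /(Ck0P _ oU) cf; apply/Ck0P => // p /sU /cf.
by move=> [df Df]; split=> [p /sU/df//|v]; exact/IH/Df.
Qed.

Lemma Ck_eq (R : realType) (V W : normedModType R) (k : nat) (U : set V)
    (f g : V -> W) : open U -> (forall p, U p -> f p = g p) ->
  Ck k U f -> Ck k U g.
Proof.
move=> oU; elim: k f g => [|k IH] f g fg.
  move=> /(Ck0P _ oU) cf; apply/Ck0P => // p Up.
  have fgp : \forall q \near p, f q = g q.
    by apply: filterS (open_nbhs_nbhs (conj oU Up)).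
  have := cf p Up; rewrite /prop_for /continuous_at (fg p Up).
  by apply: cvg_trans; apply: near_eq_cvg.
have fgn p : U p -> \forall q \near p, f q = g q.
  by move=> Up; apply: filterS (open_nbhs_nbhs (conj oU Up)).
move=> [df Df]; split=> [p Up|v].
  exact: near_eq_differentiable (fgn p Up) (df p Up).
apply: IH (Df v) => p Up; exact: near_eq_derive (fgn p Up).
Qed.

Lemma derive_comp (R : realType) (V V' W : normedModType R) (f : V' -> W)
    (g : V -> V') (x v : V) : differentiable g x -> differentiable f (g x) ->
  'D_v (f \o g) x = 'D_('D_v g x) f (g x).
Proof.
move=> dg df; rewrite deriveE; last exact: differentiable_comp.
by rewrite diff_comp //= -!deriveE.
Qed.

Lemma deriveDdir (R : realType) (V W : normedModType R) (f : V -> W)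
    (x v w : V) : differentiable f x -> 'D_(v + w) f x = 'D_v f x + 'D_w f x.
Proof. by move=> df; rewrite !deriveE // linearD. Qed.

Lemma deriveZdir (R : realType) (V W : normedModType R) (f : V -> W)
    (x v : V) (a : R) : differentiable f x -> 'D_(a *: v) f x = a *: 'D_v f x.
Proof. by move=> df; rewrite !deriveE // linearZ. Qed.

Lemma deriveNdir (R : realType) (V W : normedModType R) (f : V -> W)
    (x v : V) : differentiable f x -> 'D_(- v) f x = - 'D_v f x.
Proof. by move=> df; rewrite !deriveE // linearN. Qed.

Lemma derive_sum_partial (R : realType) (W : normedModType R) (m : nat)
    (f : 'rV[R]_m -> W) (x v : 'rV[R]_m) : differentiable f x ->
  'D_v f x = \sum_(i < m) v 0 i *: partial i f x.
Proof.
move=> df; rewrite deriveE // {1}(row_sum_delta v) linear_sum.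
by apply: eq_bigr => i _; rewrite linearZ /partial deriveE.
Qed.

Lemma Ck_cst (R : realType) (V W : normedModType R) (k : nat) (U : set V)
    (a : W) : open U -> Ck k U (cst a).
Proof.
move=> oU; elim: k a => [|k IH] a.
  by apply/Ck0P => // p _; exact: cst_continuous.
split=> [p _|v]; first exact: differentiable_cst.
by apply: Ck_eq (IH 0) => // p _; rewrite derive_cst.
Qed.

Lemma CkD (R : realType) (V W : normedModType R) (k : nat) (U : set V)
    (f g : V -> W) : open U -> Ck k U f -> Ck k U g -> Ck k U (f \+ g).
Proof.
move=> oU; elim: k f g => [|k IH] f g.
  move=> /(Ck0P _ oU) cf /(Ck0P _ oU) cg; apply/Ck0P => // p Up.
  by apply: cvgD; [exact: cf|exact: cg].
move=> [df Df] [dg Dg]; split=> [p Up|v].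
  by apply: differentiableD; [exact: df|exact: dg].
apply: Ck_eq (IH _ _ (Df v) (Dg v)) => // p Up.
by rewrite deriveD //; apply: diff_derivable; [exact: df|exact: dg].
Qed.

Lemma Ck_sum (R : realType) (V W : normedModType R) (k : nat) (U : set V)
    (I : Type) (r : seq I) (F : I -> V -> W) : open U ->
  (forall i, Ck k U (F i)) -> Ck k U (fun p => \sum_(i <- r) F i p).
Proof.
move=> oU CF; elim: r => [|i r IH].
  by apply: Ck_eq (Ck_cst k 0 oU) => // p _; rewrite big_nil.
by apply: Ck_eq (CkD oU (CF i) IH) => // p _; rewrite big_cons.
Qed.

Lemma Ck_linear (R : realType) (V W Z : normedModType R) (k : nat) (U : set V)
    (f : V -> W) (h : W -> Z) : open U ->
  (forall w, differentiable h w) -> (forall v w, 'D_v h w = h v) ->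
  Ck k U f -> Ck k U (h \o f).
Proof.
move=> oU dh Dh; elim: k f => [|k IH] f.
  move=> /(Ck0P _ oU) cf; apply/Ck0P => // p Up.
  by apply: continuous_comp; [exact: cf|exact: differentiable_continuous].
move=> [df Df]; split=> [p Up|v].
  by apply: differentiable_comp; [exact: df|exact: dh].
apply: Ck_eq (IH _ (Df v)) => // p Up.
rewrite derive_comp ?Dh //; exact: df.
Qed.

Lemma derive_coord (R : realType) (m n : nat) (i : 'I_m) (j : 'I_n)
    (v w : 'M[R]_(m, n)) : 'D_v (fun A : 'M[R]_(m, n) => A i j) w = v i j.
Proof.
have := @derive_mx _ _ _ _ id w v (@derivable_id _ _ w v); rewrite derive_id => /matrixP/(_ i j).
by rewrite mxE.
Qed.

Lemma differentiable_scalel (R : realType) (m n : nat) (w : 'M[R]_(m, n))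
  (a : R) : differentiable (fun b : R => b *: w) a.
Proof. by apply: differentiableZl; exact: ex_diff. Qed.

Lemma derive_scalel (R : realType) (m n : nat) (w : 'M[R]_(m, n)) (a b : R) :
  'D_b (fun c : R => c *: w) a = b *: w.
Proof.
rewrite deriveE; last exact: differentiable_scalel.
rewrite (@diffZl _ _ _ id) //=.
by rewrite diff_val.
Qed.

Lemma Ck_mx (R : realType) (V : normedModType R) (m n k : nat) (U : set V)
    (F : V -> 'M[R]_(m, n)) : open U ->
  Ck k U F <-> (forall i j, Ck k U (fun p => F p i j)).
Proof.
move=> oU; split=> [CF i j|CF].
  apply: (Ck_linear (h := fun A : 'M[R]_(m, n) => A i j)) CF => //.
    by move=> w; exact: differentiable_coord.
  by move=> v w; exact: derive_coord.
have CFs i j : Ck k U (fun p => F p i j *: delta_mx i j : 'M[R]_(m, n)).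
  apply: (Ck_linear (h := fun a : R => a *: (delta_mx i j : 'M[R]_(m, n)))) (CF i j) => //.
  by move=> v w; exact: derive_scalel.
have CFr i := Ck_sum (index_enum 'I_n) oU (CFs i).
apply: Ck_eq (Ck_sum (index_enum 'I_m) oU CFr) => // p _.
by rewrite -matrix_sum_delta.
Qed.

Lemma Ck_mul (R : realType) (V : normedModType R) (k : nat) (U : set V)
    (f g : V -> R) : open U -> Ck k U f -> Ck k U g -> Ck k U (f * g).
Proof.
move=> oU; elim: k f g => [|k IH] f g.
  move=> /(Ck0P _ oU) cf /(Ck0P _ oU) cg; apply/Ck0P => // p Up.
  by apply: cvgM; [exact: cf|exact: cg].
move=> Cf Cg; have [df Df] := Cf; have [dg Dg] := Cg; split=> [p Up|v].
  by apply: differentiableM; [exact: df|exact: dg].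
have := CkD oU (IH _ _ (CkS oU Cf) (Dg v)) (IH _ _ (CkS oU Cg) (Df v)).
apply: Ck_eq => // p Up.
by rewrite deriveM //; apply: diff_derivable; [exact: df|exact: dg].
Qed.

(** Induction on [k] for all [f]: by the chain rule a derivative of [f \o g] is a sum of coordinates
    of a derivative of [g] times [partial i f \o g], which is a composition of the same kind with
    one order less. The target is [R] so that [Ck_mul] applies. *)
Lemma Ck_comp_real (R : realType) (V : normedModType R) (m k : nat)
    (U : set V) (U' : set 'rV[R]_m) (g : V -> 'rV[R]_m) (f : 'rV[R]_m -> R) :
  open U -> open U' -> (forall p, U p -> U' (g p)) ->
  Ck k U g -> Ck k U' f -> Ck k U (f \o g).
Proof.
move=> oU oU' gU; elim: k f => [|k IH] f.
  move=> /(Ck0P _ oU) cg /(Ck0P _ oU') cf; apply/Ck0P => // p Up.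
  by apply: continuous_comp; [exact: cg|exact/cf/gU].
move=> Cg Cf; have [dg Dg] := Cg; have [df Df] := Cf; split=> [p Up|v].
  by apply: differentiable_comp; [exact: dg|exact/df/gU].
have Ct i : Ck k U ((fun p => 'D_v g p 0 i) * (partial i f \o g)).
  apply: Ck_mul => //; first exact: ((Ck_mx _ _ oU).1 (Dg v)).
  exact: IH (CkS oU Cg) (Df _).
apply: Ck_eq (Ck_sum (index_enum 'I_m) oU Ct) => // p Up.
rewrite derive_comp ?derive_sum_partial //; [exact/df/gU|exact: dg|].
exact/df/gU.
Qed.

Lemma Ck_comp (R : realType) (V : normedModType R) (m a b k : nat)
    (U : set V) (U' : set 'rV[R]_m) (g : V -> 'rV[R]_m)
    (f : 'rV[R]_m -> 'M[R]_(a, b)) :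
  open U -> open U' -> (forall p, U p -> U' (g p)) ->
  Ck k U g -> Ck k U' f -> Ck k U (f \o g).
Proof.
move=> oU oU' gU Cg /(Ck_mx _ _ oU') Cf; apply/Ck_mx => // i j.
exact: Ck_comp_real oU' gU Cg (Cf i j).
Qed.

Lemma ler_coord_norm (R : realType) (m n : nat) (A : 'M[R]_(m, n)) i j :
  `|A i j| <= `|A|.
Proof.
rewrite [leRHS]/Num.Def.normr/= mx_normrE.
exact: (le_bigmax _ (fun ij : 'I_m * 'I_n => `|A ij.1 ij.2|) (i, j)).
Qed.

Lemma derive_mxE (R : realType) (V : normedModType R) (m n : nat)
    (F : V -> 'M[R]_(m, n)) (x v : V) i j : differentiable F x ->
  ('D_v F x) i j = 'D_v (fun p => F p i j) x.
Proof. by move=> dF; rewrite derive_mx ?mxE //; exact: diff_derivable. Qed.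

Lemma differentiable_mxE (R : realType) (V : normedModType R) (m n : nat)
    (F : V -> 'M[R]_(m, n)) (x : V) i j : differentiable F x ->
  differentiable (fun p => F p i j) x.
Proof.
move=> dF; apply: (differentiable_comp (g := fun A : 'M[R]_(m, n) => A i j)) => //.
exact: differentiable_coord.
Qed.

Lemma Ck_differentiable (R : realType) (V W : normedModType R) (k : nat)
    (U : set V) (f : V -> W) (p : V) : Ck k.+1 U f -> U p -> differentiable f p.
Proof. by move=> [df _]; exact: df. Qed.

Lemma Ck_derive (R : realType) (V W : normedModType R) (k : nat)
    (U : set V) (f : V -> W) (v : V) : Ck k.+1 U f -> Ck k U ('D_v f).
Proof. by move=> [_]; exact. Qed.

Lemma Ck_continuous (R : realType) (V W : normedModType R) (k : nat)
    (U : set V) (f : V -> W) (p : V) : open U -> Ck k U f -> U p ->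
  {for p, continuous f}.
Proof.
move=> oU; case: k => [/Ck0P|k [df _] Up]; first exact.
exact/differentiable_continuous/df.
Qed.

Local Opaque Ck derive.

Lemma near_open (T : topologicalType) (U : set T) (P : T -> Prop) (p : T) :
  open U -> U p -> (forall q, U q -> P q) -> \forall q \near p, P q.
Proof. by move=> oU Up UP; apply: filterS (open_nbhs_nbhs (conj oU Up)). Qed.

(** * Second-order chain rule *)

Lemma derive2_sum_partial (R : realType) (m : nat) (U : set 'rV[R]_m)
    (f : 'rV[R]_m -> R) (p v w : 'rV[R]_m) : open U -> U p -> Ck 2 U f ->
  'D_v ('D_w f) p = \sum_(i < m) w 0 i * 'D_v (partial i f) p.
Proof.
move=> oU Up Cf.
rewrite (@near_eq_derive _ _ _ _ (\sum_(i < m) (w 0 i *: partial i f))).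
  rewrite derive_sum; last first.
    move=> i; apply: derivableZ; apply: diff_derivable.
    exact: (Ck_differentiable (Ck_derive _ Cf) Up).
  apply: eq_bigr => i _; rewrite deriveZ //.
  by apply: diff_derivable; exact: (Ck_differentiable (Ck_derive _ Cf) Up).
apply: near_open (Up) _ => // q Uq.
rewrite derive_sum_partial ?fct_sumE //; exact: Ck_differentiable Cf Uq.
Qed.

Lemma derive2_comp (R : realType) (V : normedModType R) (m : nat) (U : set V)
    (U' : set 'rV[R]_m) (g : V -> 'rV[R]_m) (f : 'rV[R]_m -> R) (p u v : V) :
  open U -> open U' -> (forall q, U q -> U' (g q)) -> U p ->
  Ck 2 U g -> Ck 2 U' f ->
  'D_u ('D_v (f \o g)) p =
  'D_('D_u ('D_v g) p) f (g p) + 'D_('D_u g p) ('D_('D_v g p) f) (g p).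
Proof.
move=> oU oU' gU Up Cg Cf.
have dg q : U q -> differentiable g q := Ck_differentiable Cg.
have df q : U q -> differentiable f (g q).
  by move=> /gU Uq; exact: Ck_differentiable Cf Uq.
have dDg : differentiable ('D_v g) p := Ck_differentiable (Ck_derive v Cg) Up.
have dDf i : differentiable (partial i f) (g p).
  exact: Ck_differentiable (Ck_derive _ Cf) (gU _ Up).
rewrite (@near_eq_derive _ _ _ _
    (\sum_(i < m) ((fun q => 'D_v g q 0 i) * (partial i f \o g)))); last first.
  apply: near_open (Up) _ => // q Uq.
  rewrite derive_comp ?derive_sum_partial ?fct_sumE //; by [exact: dg|exact: df].
have d1 i : derivable (fun q => 'D_v g q 0 i) p u.
  by apply: diff_derivable; exact: differentiable_mxE.
have d2 i : derivable (partial i f \o g) p u.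
  by apply: diff_derivable; apply: differentiable_comp => //; exact: dg.
rewrite derive_sum; last by move=> i; exact: derivableM.
rewrite (derive_sum_partial _ (df _ Up)) (derive2_sum_partial _ _ oU' (gU _ Up) Cf).
rewrite -big_split /=; apply: eq_bigr => i _.
rewrite deriveM // (derive_comp (f := partial i f)) //; last exact: dg.
by rewrite (derive_mxE u 0 i dDg) addrC; congr (_ + _); rewrite /GRing.scale /= mulrC.
Qed.

Lemma derive2_mxE (R : realType) (V : normedModType R) (m n : nat) (U : set V)
    (F : V -> 'M[R]_(m, n)) (p u v : V) i j : open U -> U p -> Ck 2 U F ->
  ('D_u ('D_v F) p) i j = 'D_u ('D_v (fun q => F q i j)) p.
Proof.
move=> oU Up CF; rewrite derive_mxE; last first.
  exact: Ck_differentiable (Ck_derive v CF) Up.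
apply: near_eq_derive; apply: near_open (Up) _ => // q Uq.
by rewrite derive_mxE //; exact: Ck_differentiable CF Uq.
Qed.

Lemma derive2_comp_mx (R : realType) (V : normedModType R) (m a b : nat)
    (U : set V) (U' : set 'rV[R]_m) (g : V -> 'rV[R]_m)
    (f : 'rV[R]_m -> 'M[R]_(a, b)) (p u v : V) :
  open U -> open U' -> (forall q, U q -> U' (g q)) -> U p ->
  Ck 2 U g -> Ck 2 U' f ->
  'D_u ('D_v (f \o g)) p =
  'D_('D_u ('D_v g) p) f (g p) + 'D_('D_u g p) ('D_('D_v g p) f) (g p).
Proof.
move=> oU oU' gU Up Cg Cf; apply/matrixP => i j.
have Ufg := gU _ Up.
have Cfg : Ck 2 U (f \o g) by exact: Ck_comp oU oU' gU Cg Cf.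
have Cfij : Ck 2 U' (fun q => f q i j) by exact: ((Ck_mx _ _ oU').1 Cf).
apply: etrans (derive2_mxE u v i j oU Up Cfg) _.
apply: etrans (derive2_comp u v oU oU' gU Up Cg Cfij) _.
rewrite [RHS]mxE; congr (_ + _).
  by apply: esym; exact: derive_mxE (Ck_differentiable Cf Ufg).
by apply: esym; exact: derive2_mxE oU' Ufg Cf.
Qed.

(** * Mean value theorem, symmetry of second derivatives, Lipschitz bounds *)

Lemma is_derive_line (R : realType) (V W : normedModType R) (f : V -> W)
    (x v : V) (t : R) : differentiable f (x + t *: v) ->
  is_derive t 1 (fun s : R => f (x + s *: v)) ('D_v f (x + t *: v)).
Proof.
move=> df.
have dg : is_diff t (fun s : R => x + s *: v) (fun s : R => 0 + s *: v).
  by apply: is_diffD; apply: is_diffZl.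
apply: DeriveDef.
  by apply: diff_derivable; apply: differentiable_comp.
rewrite (derive_comp (f := f) (g := fun s : R => x + s *: v)) //.
by rewrite (deriveE (f := fun s : R => x + s *: v)) // diff_val add0r scale1r.
Qed.

Lemma MVT_line (R : realType) (V : normedModType R) (f : V -> R) (x v : V) :
  (forall t : R, 0 <= t <= 1 -> differentiable f (x + t *: v)) ->
  exists2 c : R, 0 <= c <= 1 & f (x + v) - f x = 'D_v f (x + c *: v).
Proof.
move=> df.
have [|||c c01] := @MVT_segment R (fun t => f (x + t *: v))
  (fun t => 'D_v f (x + t *: v)) 0 1.
- exact: ler01.
- move=> t /itvP t01; apply: is_derive_line; apply: df.
  by rewrite !t01.
- apply: continuous_in_subspaceT => t; rewrite inE /= in_itv /= => t01.
  have [+ _] := is_derive_line (df t t01).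
  by move=> /derivable1_diffP/differentiable_continuous.
rewrite scale1r scale0r addr0 subr0 mulr1 => ->; exists c => //.
Qed.

(** The mean value theorem is used along [u] for [x |-> f (x + v) - f x], then along [v] for the
    derivative of [f] in the direction [u]. The left-hand side is symmetric in [u] and [v], so both
    mixed derivatives take this same value at nearby points. *)
Lemma second_difference (R : realType) (V : normedModType R) (U : set V)
    (f : V -> R) (p u v : V) : Ck 2 U f ->
  (forall a b : R, 0 <= a <= 1 -> 0 <= b <= 1 -> U (p + a *: u + b *: v)) ->
  exists a b : R, [/\ 0 <= a <= 1, 0 <= b <= 1 &
    f (p + u + v) - f (p + u) - (f (p + v) - f p) =
    'D_v ('D_u f) (p + a *: u + b *: v)].
Proof.
move=> Cf Uab.
have df q : U q -> differentiable f q := Ck_differentiable Cf.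
have le01 : 0 <= (0 : R) <= 1 by rewrite lexx ler01.
have le11 : 0 <= (1 : R) <= 1 by rewrite lexx ler01.
pose g := (f \o shift v) - f.
have Ua a : 0 <= a <= 1 -> U (p + a *: u).
  by move=> a01; have := Uab a 0 a01 le01; rewrite scale0r addr0.
have Uav a : 0 <= a <= 1 -> U (p + a *: u + v).
  by move=> a01; have := Uab a 1 a01 le11; rewrite scale1r.
have ds q : is_diff q (shift v) (id + 0 : V -> V).
  by apply: is_diffD.
have dfs a : 0 <= a <= 1 -> differentiable (f \o shift v) (p + a *: u).
  by move=> a01; apply: differentiable_comp => //; exact/df/Uav.
have dg a : 0 <= a <= 1 -> differentiable g (p + a *: u).
  by move=> a01; apply: differentiableB; [exact: dfs|exact/df/Ua].
have [a a01 ea] := MVT_line dg.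
have Dg : 'D_u g (p + a *: u) =
    'D_u f (p + a *: u + v) - 'D_u f (p + a *: u).
  rewrite deriveB; last 2 first.
  - by apply: diff_derivable; exact: dfs.
  - by apply: diff_derivable; exact/df/Ua.
  rewrite derive_comp //; last exact/df/Uav.
  by rewrite (deriveE _ (ex_diff (is_diff_def := ds _))) diff_val /= addr0.
have [b b01 eb] : exists2 b : R, 0 <= b <= 1 &
    'D_u f (p + a *: u + v) - 'D_u f (p + a *: u) =
    'D_v ('D_u f) (p + a *: u + b *: v).
  apply: (MVT_line (f := 'D_u f)) => b b01.
  exact: Ck_differentiable (Ck_derive u Cf) (Uab _ _ a01 b01).
exists a, b; split=> //; rewrite -eb -Dg -ea /g /= !fctE /= /shift.
ring.
Qed.

Lemma near_segments (R : realType) (V : normedModType R) (P : V -> Prop)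
    (p u v : V) : (\forall q \near p, P q) ->
  \forall s \near (0 : R)^'+, forall a b : R, 0 <= a <= 1 -> 0 <= b <= 1 ->
    P (p + a *: (s *: u) + b *: (s *: v)).
Proof.
move=> /nbhs_ballP[r /= r0 rP].
have c0 : 0 < `|u| + `|v| + 1 by rewrite ltr_wpDl // addr_ge0.
near=> s => a b /andP[a0 a1] /andP[b0 b1]; apply: rP.
rewrite -ball_normE /= -addrA opprD addNKr normrN.
have s0 : 0 < s by near: s; exact: nbhs_right_gt.
have sr : s < r / (`|u| + `|v| + 1).
  by near: s; apply: nbhs_right_lt; exact: divr_gt0.
apply: (@le_lt_trans _ _ (s * (`|u| + `|v|))).
  rewrite mulrDr (le_trans (ler_normD _ _)) // lerD // !normrZ.
    by rewrite (ger0_norm a0) (gtr0_norm s0) ler_piMl // mulr_ge0 // ltW.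
  by rewrite (ger0_norm b0) (gtr0_norm s0) ler_piMl // mulr_ge0 // ltW.
apply: (@lt_trans _ _ (s * (`|u| + `|v| + 1))); last by rewrite -ltr_pdivlMr.
by rewrite ltr_pM2l // ltrDl.
Unshelve. all: by end_near. Qed.

Lemma derive2_scale (R : realType) (V : normedModType R) (U : set V)
    (f : V -> R) (p u v : V) (s : R) : open U -> U p -> Ck 2 U f ->
  'D_(s *: v) ('D_(s *: u) f) p = s ^+ 2 * 'D_v ('D_u f) p.
Proof.
move=> oU Up Cf.
have dDf : differentiable ('D_u f) p := Ck_differentiable (Ck_derive u Cf) Up.
rewrite (@near_eq_derive _ _ _ _ (s *: 'D_u f)); last first.
  apply: near_open (Up) _ => // q Uq.
  by rewrite deriveZdir //; exact: Ck_differentiable Cf Uq.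
rewrite deriveZ; last exact: diff_derivable.
by rewrite deriveZdir // /GRing.scale /= mulrA expr2.
Qed.

(** The second difference over a parallelogram with sides [s u] and [s v] is [s^2] times either
    mixed derivative at some point of it. For small [s] both points are so close to [p] that each
    value is within half the supposed gap [2 e] of its value at [p], a contradiction. *)
Lemma deriveC (R : realType) (V : normedModType R) (U : set V)
    (f : V -> R) (p u v : V) : open U -> U p -> Ck 2 U f ->
  'D_v ('D_u f) p = 'D_u ('D_v f) p.
Proof.
move=> oU Up Cf; apply/eqP/negPn/negP => neq.
pose e := `|'D_v ('D_u f) p - 'D_u ('D_v f) p| / 2.
have e0 : 0 < e by rewrite divr_gt0 // normr_gt0 subr_eq0.
have cD a b : \forall q \near p,
    U q /\ `|'D_b ('D_a f) p - 'D_b ('D_a f) q| < e.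
  apply: filterI; first exact: open_nbhs_nbhs.
  have : {for p, continuous ('D_b ('D_a f))}.
    exact: Ck_continuous oU (Ck_derive _ (Ck_derive _ Cf)) Up.
  by move/cvgrPdist_lt => /(_ _ e0).
have [s [s0 [H1 H2]]] := filter_ex (filterI (nbhs_right_gt 0)
  (filterI (near_segments u v (cD u v)) (near_segments v u (cD v u)))).
have [|a [b [a01 b01 E1]]] := @second_difference _ _ _ _ p (s *: u) (s *: v) Cf.
  by move=> a b a01 b01; have [] := H1 a b a01 b01.
have [|c [d [c01 d01 E2]]] := @second_difference _ _ _ _ p (s *: v) (s *: u) Cf.
  by move=> c d c01 d01; have [] := H2 c d c01 d01.
have [U1 L1] := H1 a b a01 b01; have [U2 L2] := H2 c d c01 d01.
have {}E1 := etrans E1 (derive2_scale _ _ _ oU U1 Cf).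
have {}E2 := etrans E2 (derive2_scale _ _ _ oU U2 Cf).
have : s ^+ 2 * 'D_v ('D_u f) (p + a *: (s *: u) + b *: (s *: v)) =
       s ^+ 2 * 'D_u ('D_v f) (p + c *: (s *: v) + d *: (s *: u)).
  apply: etrans (esym E1) (etrans _ E2); rewrite [p + s *: v + _]addrAC; ring.
move=> /(mulfI (expf_neq0 2 (lt0r_neq0 s0))) E.
have : `|'D_v ('D_u f) p - 'D_u ('D_v f) p| < e + e.
  have triangle (x y A B : R) : `|A - x| < e -> `|B - y| < e -> x = y ->
      `|A - B| < e + e.
    move=> Ax + xy; rewrite -xy distrC => Bx.
    exact: le_lt_trans (ler_distD x _ _) (ltrD Ax Bx).
  exact: triangle L1 L2 E.
by rewrite -splitr ltxx.
Qed.

Lemma deriveC_mx (R : realType) (V : normedModType R) (m n : nat) (U : set V)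
    (F : V -> 'M[R]_(m, n)) (p u v : V) : open U -> U p -> Ck 2 U F ->
  'D_v ('D_u F) p = 'D_u ('D_v F) p.
Proof.
move=> oU Up CF; apply/matrixP => i j.
apply: etrans (derive2_mxE v u i j oU Up CF) _.
apply: etrans _ (esym (derive2_mxE u v i j oU Up CF)).
exact: deriveC u v oU Up ((Ck_mx _ _ oU).1 CF i j).
Qed.

(** Mean value theorem on the segment from [w] to [z], which stays in the ball by convexity. The
    norm on row vectors is the sup norm, so the sum of local bounds for the partial derivatives is a
    Lipschitz constant. *)
Lemma Ck1_lipschitz (R : realType) (n : nat) (U : set 'rV[R]_n)
    (f : 'rV[R]_n -> R) (p : 'rV[R]_n) : open U -> U p -> Ck 1 U f ->
  exists C r : R, [/\ 0 <= C, 0 < r & forall z w, ball p r z -> ball p r w ->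
    `|f z - f w| <= C * `|z - w|].
Proof.
move=> oU Up Cf.
have cP i : \forall q \near p, `|partial i f q| <= `|partial i f p| + 1.
  have : {for p, continuous (partial i f)}.
    exact: Ck_continuous oU (Ck_derive _ Cf) Up.
  move/cvgrPdist_lt => /(_ 1 ltr01); apply: filterS => q; rewrite distrC => h.
  have := le_lt_trans (ler_dist_dist _ _) h; rewrite ltr_norml => /andP[_ ?]; lra.
have : \forall q \near p, U q /\ forall i, `|partial i f q| <= `|partial i f p| + 1.
  by apply: filterI; [exact: open_nbhs_nbhs|exact: filter_forall cP].
move=> /nbhs_ballP[r /= r0 rP].
exists (\sum_(i < n) (`|partial i f p| + 1)), r; split=> //.
  by apply: sumr_ge0 => i _; rewrite addr_ge0.
move=> z w zr wr.
have rt (t : R) : 0 <= t <= 1 -> ball p r (w + t *: (z - w)).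
  move=> /andP[t0 t1]; move: zr wr; rewrite -!ball_normE /= => zr wr.
  have -> : p - (w + t *: (z - w)) = (1 - t) *: (p - w) + t *: (p - z).
    by apply/matrixP => i j; rewrite !mxE; ring.
  rewrite (le_lt_trans (ler_normD _ _)) // !normrZ !ger0_norm ?subr_ge0 //.
  have [->|tn0] := eqVneq t 0; first by rewrite mul0r addr0 subr0 mul1r.
  have tp : 0 < t by rewrite lt_neqAle eq_sym tn0.
  have -> : r = (1 - t) * r + t * r by ring.
  by apply: ler_ltD; [rewrite ler_wpM2l ?subr_ge0 // ltW|rewrite ltr_pM2l].
have [|c c01] := @MVT_line _ _ f w (z - w).
  by move=> t /rt/rP[Ut _]; exact: Ck_differentiable Cf Ut.
rewrite [w + (z - w)]addrC subrK => ->.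
have [Uc Pc] := rP _ (rt c c01).
rewrite derive_sum_partial; last exact: Ck_differentiable Cf Uc.
rewrite (le_trans (ler_norm_sum _ _ _)) // mulr_suml; apply: ler_sum => i _.
rewrite normrZ mulrC ler_pM //; exact: ler_coord_norm.
Qed.

(** * Maxima of upper semicontinuous functions and penalization *)

Lemma lt_real_between (R : realType) (x : \bar R) (b : R) : (x < b%:E)%E ->
  exists2 c : R, (x < c%:E)%E & c < b.
Proof.
case: x => [r| |] //; last by exists (b - 1); rewrite ?ltNyr // ltrBlDr ltrDl.
rewrite lte_fin => rb; exists ((r + b) / 2); first rewrite lte_fin; lra.
Qed.

Lemma lt_ereal_between (R : realType) (x y : \bar R) : (x < y)%E ->
  exists2 c : R, (x < c%:E)%E & (c%:E < y)%E.
Proof.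
case: y => [b|xy|]; first by move=> /lt_real_between[c]; exists c.
  case: x xy => [r| |] //.
    by exists (r + 1); rewrite ?ltry // lte_fin ltrDl.
  by exists 0; rewrite ?ltNyr ?ltry.
by rewrite ltNge leNye.
Qed.

Definition usc_at (R : realType) (T : topologicalType) (f : T -> \bar R)
    (x : T) : Prop :=
  forall a : R, (f x < a%:E)%E -> \forall y \near x, (f y < a%:E)%E.

Lemma compact_usc_max (R : realType) (T : topologicalType) (K : set T)
    (f : T -> \bar R) : compact K -> K !=set0 ->
  (forall x, K x -> usc_at f x) ->
  exists2 x, K x & forall y, K y -> (f y <= f x)%E.
Proof.
move=> /compact_near_coveringP cK [x0 Kx0] uf.
pose s := ereal_sup (f @` K).
have fs y : K y -> (f y <= s)%E by move=> Ky; apply: ereal_sup_ubound; exists y.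
have [[x Kx fx]|nmax] := pselect (exists2 x, K x & f x = s).
  by exists x => // y Ky; rewrite fx; exact: fs.
have {}fs y : K y -> (f y < s)%E.
  move=> Ky; rewrite lt_neqAle fs // andbT; apply/eqP => fy.
  by apply: nmax; exists y.
(* Filter of the values that increase to the unattained supremum [s]. Each point has a neighbourhood
   where [f < c] for all [c] close to [s]; compactness makes this uniform, so that [f] stays below
   some [b < s] on [K]. *)
pose F := filter_from [set b : \bar R | (b < s)%E] (fun b => [set c | (b <= c < s)%E]).
have FF : Filter F.
  apply: filter_from_filter; first by exists (f x0); exact: fs.
  move=> b c /= bs cs; exists (maxe b c); first by rewrite /= gt_max bs.
  by move=> d /=; rewrite ge_max => /andP[/andP[-> ->] ->].
have [x Kx|b /= bs Pb] := cK _ F (fun c y => (f y < c)%E) FF.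
  have [c xc cs] := lt_ereal_between (fs x Kx).
  exists ([set y | (f y < c%:E)%E], [set d | (c%:E <= d < s)%E]).
    by split; [exact: uf|exists c%:E].
  by move=> [y d] /= [yc /andP[cd _]]; exact: lt_le_trans yc cd.
have : (s <= b)%E.
  apply: ge_ereal_sup => _ [y Ky <-]; apply/ltW.
  by apply: Pb Ky => /=; rewrite lexx bs.
by rewrite leNgt bs.
Qed.

Lemma lteBfin (R : realType) (x : \bar R) (a b : R) :
  (x - a%:E < b%:E)%E = (x < (b + a)%:E)%E.
Proof.
case: x => [r| |]; last by rewrite !ltNyr.
  by rewrite -EFinB !lte_fin ltrBlDr.
by [].
Qed.

Lemma usc_atB (R : realType) (T : topologicalType) (f : T -> \bar R)
    (g : T -> R) (x : T) : usc_at f x -> {for x, continuous g} ->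
  usc_at (fun y => f y - (g y)%:E)%E x.
Proof.
move=> uf cg a; rewrite lteBfin => /lt_real_between[c xc cb].
have e0 : 0 < a + g x - c by rewrite subr_gt0.
move/cvgrPdist_lt : cg => /(_ _ e0) gx.
near=> y; rewrite lteBfin.
apply: (@lt_trans _ _ c%:E); first by near: y; exact: uf.
rewrite lte_fin.
have : `|g x - g y| < a + g x - c by near: y; exact: gx.
rewrite ltr_norml => /andP[_ ?]; lra.
Unshelve. all: by end_near. Qed.

(* As the penalty parameter [k] grows, the maxima of [h - k P] over [K]
   concentrate at [x0], and the penalty [k P] tends to 0 there. *)
Lemma penalized_max (R : realType) (T : topologicalType) (K N : set T)
    (h : T -> \bar R) (P : T -> R) (x0 : T) (d : R) :
  compact K -> K x0 -> nbhs x0 N -> 0 < d ->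
  (forall x, K x -> usc_at h x) -> (forall x, K x -> (h x < +oo)%E) ->
  (forall x, K x -> {for x, continuous P}) -> (forall x, 0 <= P x) ->
  h x0 = 0%E -> P x0 = 0 ->
  (forall x, K x -> P x = 0 -> x <> x0 -> (h x < 0)%E) ->
  exists k x, [/\ 0 <= k, K x /\ N x, k * P x < d,
    (0 <= h x - (k * P x)%:E)%E &
    forall y, K y -> (h y - (k * P y)%:E <= h x - (k * P x)%:E)%E].
Proof.
move=> cK Kx0 Nx0 d0 uh hoo cP P0 hx0 Px0 h0.
(* For large [k], each point has a neighbourhood on which either the penalized value is negative,
   which excludes a maximum because the value at [x0] is 0, or the point lies in [N] with [h < d].
   Compactness then provides one [k] for the whole of [K]. *)
have cov x : K x -> \forall y \near x & k \near +oo,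
    (h y - (k * P y)%:E < 0)%E \/ N y /\ (h y < d%:E)%E.
  move=> Kx; have [->|/eqP xx0] := eqVneq x x0.
    have hd : (h x0 < d%:E)%E by rewrite hx0 lte_fin.
    exists (N `&` [set y | (h y < d%:E)%E], setT).
      by split; [apply: filterI => //; exact: uh|exact: filterT].
    by move=> [y k] /= [[Ny hy] _]; right.
  have [Px|Px] := eqVneq (P x) 0.
    have hx : (h x < 0%:E)%E by exact: h0.
    exists ([set y | (h y < 0%:E)%E], [set k | 0 < k]).
      by split; [exact: uh|exact: nbhs_pinfty_gt].
    move=> [y k] /= [hy k0]; left; rewrite lteBfin add0r.
    by apply: lt_le_trans hy _; rewrite lee_fin mulr_ge0 // ltW.
  have {}Px : 0 < P x by rewrite lt_neqAle eq_sym Px P0.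
  have [a xa _] := lt_ereal_between (hoo x Kx).
  (* A positive majorant of the local bound [a]: it makes the threshold for [k] positive, so that
     [k] times a lower bound of [P] exceeds [a] also when [a] is negative. *)
  have [e e0 ae] : exists2 e : R, 0 < e & a <= e.
    by exists (Num.max a 1); rewrite ?lt_max ?ltr01 ?orbT // le_max lexx.
  exists ([set y | (h y < a%:E)%E /\ P x / 2 < P y], [set k | e / (P x / 2) < k]).
    split; last by apply: nbhs_pinfty_gt; exact: num_real.
    apply: filterI; first exact: uh.
    have /cvgrPdist_lt/(_ _ (divr_gt0 Px (ltr0Sn R 1))) := cP x Kx.
    apply: filterS => y; rewrite ltr_norml => /andP[_ ?]; lra.
  have P20 : 0 < P x / 2 by rewrite divr_gt0.
  move=> [y k] /= [[hy Py] ke]; left.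
  have k0 : 0 < k := lt_trans (divr_gt0 e0 P20) ke.
  rewrite lteBfin add0r.
  apply: lt_le_trans hy _; rewrite lee_fin (le_trans ae) //.
  move: ke; rewrite ltr_pdivrMr // => /ltW/le_trans; apply.
  by rewrite ler_pM2l // ltW.
have [k [k0 Hk]] : exists k : R, 0 < k /\
    forall y, K y -> (h y - (k * P y)%:E < 0)%E \/ N y /\ (h y < d%:E)%E.
  have Hk := (compact_near_coveringP K).1 cK _ _ _ _ cov.
  have {}Hk := Hk ltac:(typeclasses eauto).
  have [k [k0 Pk]] := filter_ex (filterI (nbhs_pinfty_gt (num_real (0 : R))) Hk).
  by exists k.
have [||x Kx maxx] := @compact_usc_max R T K (fun y => h y - (k * P y)%:E)%E cK.
  by exists x0.
  move=> y Ky; apply: usc_atB; first exact: uh.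
  by apply: cvgM; [exact: cvg_cst|exact: cP].
have hx : (0 <= h x - (k * P x)%:E)%E.
  by have := maxx _ Kx0; rewrite hx0 Px0 mulr0 sube0.
exists k, x; have [|[Nx hd]] := Hk x Kx; first by rewrite ltNge hx.
split=> //; first exact: ltW.
(* The penalized maximum is at least 0, so the penalty is at most [h x], which is below [d]. *)
rewrite -lte_fin; apply: le_lt_trans hd.
by move: hx; case: (h x) => [r| |] //; rewrite ?leey // -EFinB !lee_fin subr_ge0.
Qed.

(** * The Levi form in real coordinates and its behaviour under pseudo-holomorphic maps *)

(** Let [A] be the constant field [a] and [B] the field [a J]. If [J^2 = -1], then [J] anticommutes
    with its derivatives, and [levi_dir] is the derivative of [B] along itself plus [J[A, B]]. Hence
    [levi] is [A A + B B + J[A, B]], the intrinsic formula for the hessian at [V = A - i B]. *)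
Definition levi_dir (R : realType) (n : nat) (J : 'rV[R]_n -> 'M[R]_n)
    (a p : 'rV[R]_n) : 'rV[R]_n :=
  a *m 'D_(a *m J p) J p - (a *m J p) *m 'D_a J p.

(* The complex hessian in the direction [a - i a J], see [hessian_levi]. *)
Definition levi (R : realType) (n : nat) (W : normedModType R)
    (J : 'rV[R]_n -> 'M[R]_n) (a : 'rV[R]_n) (f : 'rV[R]_n -> W)
    (p : 'rV[R]_n) : W :=
  'D_a ('D_a f) p + 'D_(a *m J p) ('D_(a *m J p) f) p +
  'D_(levi_dir J a p) f p.

Lemma Ck_mulmx (R : realType) (V : normedModType R) (a b c k : nat) (U : set V)
    (A : V -> 'M[R]_(a, b)) (B : V -> 'M[R]_(b, c)) : open U ->
  Ck k U A -> Ck k U B -> Ck k U (fun p => A p *m B p).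
Proof.
move=> oU /(Ck_mx _ _ oU) CA /(Ck_mx _ _ oU) CB; apply/Ck_mx => // i j.
have CAB l := Ck_mul oU (CA i l) (CB l j).
by apply: Ck_eq (Ck_sum (index_enum 'I_b) oU CAB) => // p _; rewrite mxE.
Qed.

Lemma derive_mulmx (R : realType) (V : normedModType R) (a b c : nat)
    (A : V -> 'M[R]_(a, b)) (B : V -> 'M[R]_(b, c)) (p v : V) :
  differentiable A p -> differentiable B p ->
  'D_v (fun q => A q *m B q) p = 'D_v A p *m B p + A p *m 'D_v B p.
Proof.
move=> dA dB.
have dAB i j k : derivable (fun q => A q i k * B q k j) p v.
  apply: (derivableM (f := fun q => A q i k) (g := fun q => B q k j));
  by apply: diff_derivable; exact: differentiable_mxE.
have eAB i j : (fun q => (A q *m B q) i j) =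
    \sum_k (fun q => A q i k * B q k j).
  by apply/funext => q; rewrite mxE fct_sumE.
rewrite derive_mx; last first.
  by apply/derivable_mxP => i j; rewrite eAB; exact: derivable_sum.
apply/matrixP => i j; rewrite !mxE eAB derive_sum // -big_split /=.
apply: eq_bigr => k _.
rewrite (deriveM (f := fun q => A q i k) (g := fun q => B q k j)); last 2 first.
- by apply: diff_derivable; exact: differentiable_mxE.
- by apply: diff_derivable; exact: differentiable_mxE.
by rewrite !derive_mxE // addrC; congr (_ + _); rewrite /GRing.scale /= mulrC.
Qed.

Lemma jacobianE (R : realType) (m n : nat) (f : 'rV[R]_m -> 'rV[R]_n) p i j :
  differentiable f p -> jacobian f p i j = partial i f p 0 j.
Proof.
move=> df; rewrite /partial deriveEjacobian //.
by rewrite -rowE [RHS]mxE.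
Qed.

Lemma Ck_jacobian (R : realType) (m n k : nat) (U : set 'rV[R]_m)
    (f : 'rV[R]_m -> 'rV[R]_n) : open U -> Ck k.+1 U f ->
  Ck k U (jacobian f).
Proof.
move=> oU Cf; apply/Ck_mx => // i j.
have Cij := (Ck_mx _ _ oU).1 (Ck_derive (delta_mx 0 i) Cf) 0 j.
apply: Ck_eq Cij => // p Up.
by rewrite jacobianE //; exact: Ck_differentiable Cf Up.
Qed.

Lemma mulmx_derive_jacobian (R : realType) (m n : nat) (U : set 'rV[R]_m)
    (f : 'rV[R]_m -> 'rV[R]_n) (p e w : 'rV[R]_m) : open U -> U p ->
  Ck 2 U f -> w *m 'D_e (jacobian f) p = 'D_e ('D_w f) p.
Proof.
move=> oU Up Cf.
have dJ : differentiable (jacobian f) p.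
  exact: Ck_differentiable (Ck_jacobian oU Cf) Up.
have := derive_mulmx e (differentiable_cst w p) dJ.
rewrite derive_cst mul0mx add0r => <-.
apply: near_eq_derive; apply: near_open (Up) _ => // q Uq.
by rewrite deriveEjacobian //; exact: Ck_differentiable Cf Uq.
Qed.

(** Here [Xa], [Ya], [ZA] stand for derivatives of [J'], [Df], [J] along [a] or its image, and [Xb],
    [Yb], [ZB] for those along [b = a J']. The last two hypotheses are the differentiated relation
    [J' Df = Df J(f)]. In their difference the terms ending in [j] cancel because second derivatives
    of [f] are symmetric. *)
Lemma pseudoholomorphic_algebra (R : realType) (m n : nat) (a b : 'rV[R]_m)
    (j' Xa Xb : 'M[R]_m) (D Ya Yb : 'M[R]_(m, n)) (j ZA ZB : 'M[R]_n) :
  b = a *m j' -> b *m j' = - a -> a *m Yb = b *m Ya ->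
  (a *m Xb) *m D + (a *m j') *m Yb = (a *m Yb) *m j + (a *m D) *m ZB ->
  (b *m Xa) *m D + (b *m j') *m Ya = (b *m Ya) *m j + (b *m D) *m ZA ->
  a *m Ya + b *m Yb + (a *m Xb - b *m Xa) *m D =
  (a *m D) *m ZB - (b *m D) *m ZA.
Proof.
move=> eb bj sY; rewrite bj -eb sY mulNmx mulmxBl => E1 E2.
apply/matrixP => i l; move/matrixP/(_ i l): E1; move/matrixP/(_ i l): E2.
rewrite !mxE; lra.
Qed.

(** This is the identity that makes the Levi form invariant: by the chain rule, it amounts to
    [levi J' a (h \o f)] at [p] being [levi J] of [h] at [f p] in the direction of the derivative of
    [f] along [a]. It comes from differentiating [J' Df = Df J(f)] along [a] and along [a J']. *)
Lemma levi_pseudoholomorphic (R : realType) (m n : nat) (U' : set 'rV[R]_m)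
    (U : set 'rV[R]_n) (f : 'rV[R]_m -> 'rV[R]_n)
    (J' : 'rV[R]_m -> 'M[R]_m) (J : 'rV[R]_n -> 'M[R]_n) (a p : 'rV[R]_m) :
  open U' -> open U -> U' p -> (forall q, U' q -> U (f q)) ->
  Ck 2 U' f -> Ck 1 U' J' -> Ck 1 U J -> J' p *m J' p = - 1%:M ->
  (forall q, U' q -> J' q *m jacobian f q = jacobian f q *m J (f q)) ->
  levi J' a f p = levi_dir J ('D_a f p) (f p).
Proof.
move=> oU' oU U'p fU Cf CJ' CJ JJ fJ.
pose b := a *m J' p.
have df : differentiable f p := Ck_differentiable Cf U'p.
have dJ' : differentiable J' p := Ck_differentiable CJ' U'p.
have dj : differentiable (jacobian f) p.
  exact: Ck_differentiable (Ck_jacobian oU' Cf) U'p.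
have dJ : differentiable J (f p) := Ck_differentiable CJ (fU _ U'p).
have dJf : differentiable (J \o f) p by exact: differentiable_comp.
have E (e w : 'rV[R]_m) : (w *m 'D_e J' p) *m jacobian f p + (w *m J' p) *m 'D_e (jacobian f) p
    = (w *m 'D_e (jacobian f) p) *m J (f p) +
      (w *m jacobian f p) *m 'D_('D_e f p) J (f p).
  have e1 := derive_mulmx e dJ' dj.
  have e2 := derive_mulmx e dj dJf.
  have e3 : 'D_e (fun q => J' q *m jacobian f q) p =
      'D_e (fun q => jacobian f q *m (J \o f) q) p.
    by apply: near_eq_derive; apply: near_open (U'p) _ => // q; exact: fJ.
  have := congr1 (mulmx w) (etrans (esym e1) (etrans e3 e2)).
  by rewrite !mulmxDr !mulmxA (derive_comp e df dJ).
have ebD : 'D_a f p *m J (f p) = b *m jacobian f p.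
  by rewrite deriveEjacobian // -mulmxA -(fJ _ U'p) mulmxA.
have eBf : 'D_b f p = b *m jacobian f p by rewrite deriveEjacobian.
have eAf : 'D_a f p = a *m jacobian f p by rewrite deriveEjacobian.
have sY : a *m 'D_b (jacobian f) p = b *m 'D_a (jacobian f) p.
  apply: etrans (mulmx_derive_jacobian b a oU' U'p Cf) _.
  apply: etrans _ (esym (mulmx_derive_jacobian a b oU' U'p Cf)).
  exact: deriveC_mx oU' U'p Cf.
have bj : b *m J' p = - a by rewrite /b -mulmxA JJ mulmxN mulmx1.
have := pseudoholomorphic_algebra (erefl b) bj sY (E b a) (E a b).
rewrite /levi_dir ebD -eBf -eAf => <-.
rewrite /levi /levi_dir -/b; congr (_ + _ + _).
- by apply: esym; exact: mulmx_derive_jacobian oU' U'p Cf.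
- by apply: esym; exact: mulmx_derive_jacobian oU' U'p Cf.
- exact: deriveEjacobian.
Qed.

(** * The complex hessian as a real Levi form *)

Local Notation toC := (real_complex _ : _ -> Cx _).

Lemma toC_rect (R : realType) (r s : R) :
  toC r + 'i * toC s = (Complex r s : Cx R).
Proof. by rewrite -complexiE; simpc. Qed.

Lemma cmx_rectE (R : realType) (m n : nat) (x y : 'M[R]_(m, n)) i k :
  (cmx x + 'i *: cmx y) i k = Complex (x i k) (y i k).
Proof. by rewrite !mxE toC_rect. Qed.

Definition gradient (R : realType) (n : nat) (f : 'rV[R]_n -> R)
    (p : 'rV[R]_n) : 'cV[R]_n := \col_k partial k f p.

Lemma mulmx_gradient (R : realType) (n : nat) (f : 'rV[R]_n -> R)
    (v p : 'rV[R]_n) : differentiable f p ->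
  (v *m gradient f p) 0 0 = 'D_v f p.
Proof.
move=> df; rewrite derive_sum_partial // mxE.
by apply: eq_bigr => i _; rewrite mxE.
Qed.

Lemma Ck_gradient (R : realType) (n k : nat) (U : set 'rV[R]_n)
    (f : 'rV[R]_n -> R) : open U -> Ck k.+1 U f -> Ck k U (gradient f).
Proof.
move=> oU Cf; apply/Ck_mx => // i j.
by apply: Ck_eq (Ck_derive (delta_mx 0 i) Cf) => // p _; rewrite mxE.
Qed.

Lemma mulmx_derive_gradient (R : realType) (n : nat) (U : set 'rV[R]_n)
    (f : 'rV[R]_n -> R) (e v p : 'rV[R]_n) : open U -> U p -> Ck 2 U f ->
  (v *m 'D_e (gradient f) p) 0 0 = 'D_e ('D_v f) p.
Proof.
move=> oU Up Cf; rewrite (derive2_sum_partial e v oU Up Cf) mxE.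
have dg : differentiable (gradient f) p.
  exact: Ck_differentiable (Ck_gradient oU Cf) Up.
apply: eq_bigr => i _; congr (_ * _); apply: etrans (derive_mxE e i 0 dg) _.
by apply: (congr1 (fun h => 'D_e h p)); apply/funext => q; rewrite mxE.
Qed.

(** The column [c] holds the coefficients of the 1-form [df \o J], so the right-hand side is the
    exterior derivative of that form evaluated on [(a J, a)]. *)
Lemma levi_gradient (R : realType) (n : nat) (U : set 'rV[R]_n)
    (J : 'rV[R]_n -> 'M[R]_n) (f : 'rV[R]_n -> R) (a p : 'rV[R]_n) :
  open U -> U p -> Ck 2 U f -> Ck 1 U J -> J p *m J p = - 1%:M ->
  let c := fun q => J q *m gradient f q in
  levi J a f p = (a *m 'D_(a *m J p) c p - (a *m J p) *m 'D_a c p) 0 0.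
Proof.
move=> oU Up Cf CJ JJ c; set b := a *m J p.
have df : differentiable f p := Ck_differentiable Cf Up.
have dJ : differentiable J p := Ck_differentiable CJ Up.
have dg : differentiable (gradient f) p.
  exact: Ck_differentiable (Ck_gradient oU Cf) Up.
have bj : b *m J p = - a by rewrite /b -mulmxA JJ mulmxN mulmx1.
have Db := derive_mulmx b dJ dg.
have Da := derive_mulmx a dJ dg.
rewrite {}/c Db Da !mulmxDr !mulmxA bj -/b mulNmx.
rewrite /levi /levi_dir -/b.
rewrite -(mulmx_gradient _ df) -(mulmx_derive_gradient _ _ oU Up Cf).
rewrite -(mulmx_derive_gradient _ _ oU Up Cf) mulmxBl.
have collect (x1 x2 x3 x4 : 'M[R]_1) :
    x1 0 0 + x2 0 0 + (x3 - x4) 0 0 = (x3 + x2 - (x4 - x1)) 0 0.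
  by rewrite !mxE; ring.
exact: collect.
Qed.

Lemma T10P (R : realType) (n : nat) (j : 'M[R]_n) (V : 'rV[Cx R]_n) :
  T10 j V -> let a := map_mx (@complex.Re R) V in
  V = cmx a - 'i *: cmx (a *m j).
Proof.
move=> VJ a.
have Vab : V = cmx a + 'i *: cmx (map_mx (@complex.Im R) V).
  by apply/matrixP => i k; rewrite cmx_rectE !mxE; case: (V i k).
suff -> : a *m j = - map_mx (@complex.Im R) V.
  by rewrite /cmx map_mxN scalerN opprK.
move: VJ; rewrite /T10 {1}Vab mulmxDl -scalemxAl -!map_mxM => /matrixP VJ.
apply/matrixP => i k; have := congr1 (@complex.Re R) (VJ i k).
rewrite cmx_rectE /= => ->.
by rewrite mxE mulrC -complexiE ReiNIm !mxE.
Qed.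

(** [V] and its conjugate have types (1,0) and (0,1), so the second projected term vanishes and the
    first loses its projections. On such a pair [del] may be replaced by [d1]. *)
Lemma hessian_T10 (R : realType) (n : nat) (j : 'M[R]_n) (V : 'rV[Cx R]_n)
    (w : 'M[Cx R]_n) : T10 j V ->
  (V *m (proj10 j *m w *m (proj01 j)^T + proj01 j *m w *m (proj10 j)^T)
    *m (map_mx Num.conj V)^T) = V *m w *m (map_mx Num.conj V)^T.
Proof.
move=> VJ.
have half (x : 'rV[Cx R]_n) : 2^-1 *: (x + x) = x.
  by rewrite scalerDr -scalerDl -mulr2n -[_ *+ 2]mulr_natr mulVf ?scale1r ?pnatr_eq0.
have V10 : V *m proj10 j = V.
  rewrite /proj10 -scalemxAr mulmxBr mulmx1 -scalemxAr VJ scalerA -expr2 sqrCi.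
  by rewrite scaleN1r opprK half.
have V01 : V *m proj01 j = 0.
  rewrite /proj01 -scalemxAr mulmxDr mulmx1 -scalemxAr VJ scalerA -expr2 sqrCi.
  by rewrite scaleN1r subrr scaler0.
pose W : 'rV[Cx R]_n := map_mx Num.conj V.
have WJ : W *m cmx j = - 'i *: W.
  apply/matrixP => i k; have /matrixP/(_ i k)/(congr1 Num.conj) := VJ.
  rewrite !mxE rmorph_sum rmorphM /= conjCi => <-.
  apply: eq_bigr => l _; rewrite !mxE rmorphM /=; congr (_ * _); apply: esym.
  by apply: conj_Creal; apply/complex_realP; exists (j l k).
have W01 : W *m proj01 j = W.
  rewrite /proj01 -scalemxAr mulmxDr mulmx1 -scalemxAr WJ scalerA mulrN -expr2.
  by rewrite sqrCi opprK scale1r half.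
have project (P Q : 'M[Cx R]_n) : V *m Q = V -> V *m P = 0 -> W *m P = W ->
    V *m (Q *m w *m P^T + P *m w *m Q^T) *m W^T = V *m w *m W^T.
  move=> VQ VP WP; rewrite mulmxDr !mulmxA VQ VP !mul0mx addr0.
  by rewrite -mulmxA -trmx_mul WP.
exact: project.
Qed.

Lemma dbarE (R : realType) (n : nat) (J : 'rV[R]_n -> 'M[R]_n)
    (f : 'rV[R]_n -> R) (q : 'rV[R]_n) k :
  dbar J f q k 0 =
  (Complex (2^-1 * partial k f q) (2^-1 * (J q *m gradient f q) k 0) : Cx R).
Proof.
have -> : dbar J f q =
    cmx (2^-1 *: gradient f q) + 'i *: cmx (2^-1 *: (J q *m gradient f q)).
  have d0E : d0 f q = cmx (gradient f q) by apply/matrixP => i l; rewrite !mxE.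
  have toC2 : real_complex R 2^-1 = 2^-1 :> Cx R.
    apply: etrans (fmorphV (real_complex R) 2) _; congr (_^-1).
    exact: (rmorph_nat (real_complex R) 2).
  rewrite /dbar /proj01 d0E -scalemxAl mulmxDl mul1mx -scalemxAl -map_mxM.
  have cmxZ (x : 'cV[R]_n) : cmx (2^-1 *: x) = 2^-1 *: cmx x.
    by apply/matrixP => i l; rewrite !mxE -toC2 -rmorphM.
  by rewrite -/(cmx _) !cmxZ scalerDr !scalerA mulrC.
by rewrite -toC_rect !mxE.
Qed.

(** Since [dbar J f] is half of [df + i (df \o J)] and [d (df) = 0] by symmetry of second
    derivatives, only [i/2] times the exterior derivative of [df \o J] remains. *)
Lemma d1_dbar (R : realType) (n : nat) (U : set 'rV[R]_n)
    (J : 'rV[R]_n -> 'M[R]_n) (f : 'rV[R]_n -> R) (p : 'rV[R]_n) :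
  open U -> U p -> Ck 2 U f -> Ck 1 U J ->
  let c := fun q => J q *m gradient f q in
  d1 (dbar J f) p = 'i *: cmx (\matrix_(j, k)
    (2^-1 * ('D_(delta_mx 0 j) c p k 0 - 'D_(delta_mx 0 k) c p j 0))).
Proof.
move=> oU Up Cf CJ c.
have Cc : Ck 1 U c by exact: Ck_mulmx oU CJ (Ck_gradient oU Cf).
have dc : differentiable c p := Ck_differentiable Cc Up.
have dpf k : differentiable (partial k f) p.
  exact: Ck_differentiable (Ck_derive _ Cf) Up.
have half (h : 'rV[R]_n -> R) v : differentiable h p ->
    'D_v (fun q => 2^-1 * h q) p = 2^-1 * 'D_v h p.
  move=> dh; have := @deriveZ _ _ _ h 2^-1 p v (diff_derivable dh).
  exact.
have cpE j k : cpartial j (fun q => dbar J f q k 0) p =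
    Complex (2^-1 * partial j (partial k f) p) (2^-1 * 'D_(delta_mx 0 j) c p k 0).
  rewrite /cpartial; congr Complex.
    apply: etrans _ (half _ _ (dpf k)).
    apply: (congr1 (fun h => 'D_(delta_mx 0 j) h p)).
    by apply/funext => q; rewrite dbarE.
  apply: etrans _ (etrans (half _ _ (differentiable_mxE k 0 dc)) _).
    apply: (congr1 (fun h => 'D_(delta_mx 0 j) h p)).
    by apply/funext => q; rewrite dbarE.
  by congr (_ * _); apply: esym; exact: derive_mxE.
apply/matrixP => j k; rewrite mxE cpE cpE !mxE.
have -> : partial j (partial k f) p = partial k (partial j f) p.
  exact: deriveC oU Up Cf.
have collect (x r s : R) : Complex x (2^-1 * r) - Complex x (2^-1 * s) =
    'i * toC (2^-1 * (r - s)) :> Cx R.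
  rewrite -complexiE; apply/eqP; rewrite eq_complex /=.
  by apply/andP; split; apply/eqP; ring.
exact: collect.
Qed.

(** With [V = a - i b], [b = a J] and a real antisymmetric [T], the form [i T] takes on [V] and its
    conjugate the value [T(b, a) - T(a, b) = 2 T(b, a)]. The 2 cancels the factor one half in
    [d1_dbar], and [levi_gradient] identifies the result. *)
Lemma hessian_levi (R : realType) (n : nat) (U : set 'rV[R]_n)
    (J : 'rV[R]_n -> 'M[R]_n) (f : 'rV[R]_n -> R) (p : 'rV[R]_n)
    (V : 'rV[Cx R]_n) :
  open U -> U p -> Ck 2 U f -> Ck 1 U J -> J p *m J p = - 1%:M ->
  T10 (J p) V ->
  hessian J f p V V = toC (levi J (map_mx (@complex.Re R) V) f p).
Proof.
move=> oU Up Cf CJ JJ VJ; set a := map_mx _ V; pose b := a *m J p.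
rewrite /hessian /del (hessian_T10 _ VJ) (d1_dbar oU Up Cf CJ).
rewrite (levi_gradient a oU Up Cf CJ JJ).
set c := (fun q => J q *m gradient f q).
set T := \matrix_(j, k) _.
have dc : differentiable c p.
  exact: Ck_differentiable (Ck_mulmx oU CJ (Ck_gradient oU Cf)) Up.
have Vab : V = cmx a - 'i *: cmx b by exact: (T10P VJ).
have Wab : map_mx Num.conj V = cmx a + 'i *: cmx b.
  apply/matrixP => i k; rewrite mxE {1}Vab !mxE rmorphB rmorphM /= conjCi.
  by rewrite mulNr opprK !conj_Creal //; apply/complex_realP; eexists.
pose S (x y : 'rV[R]_n) := (x *m T *m y^T) 0 0.
have TT : T^T = - T by apply/matrixP => j k; rewrite !mxE; ring.
have SN x y : S x y = - S y x.
  have -> : S x y = ((x *m T *m y^T)^T) 0 0 by rewrite [RHS]mxE.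
  by rewrite !trmx_mul trmxK TT mulNmx mulmxN mulmxA mxE.
have SC x y : (cmx x *m cmx T *m (cmx y)^T) 0 0 = toC (S x y).
  have -> : (cmx y)^T = cmx y^T by apply/matrixP => i k; rewrite !mxE.
  by rewrite -!map_mxM mxE.
have S0 x : S x x = 0 by have := SN x x; lra.
have -> : (V *m ('i *: cmx T) *m (map_mx Num.conj V)^T) 0 0 =
    toC (S b a - S a b).
  rewrite Wab {1}Vab.
  have -> : (cmx a + 'i *: cmx b)^T = (cmx a)^T + 'i *: (cmx b)^T.
    by apply/matrixP => i k; rewrite !mxE.
  rewrite -[_ *m ('i *: _)]scalemxAr mulmxBl -scalemxAl -scalemxAl.
  rewrite mulmxDr -[_ *m ('i *: _)]scalemxAr !mulmxBl -!scalemxAl.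
  have entry (x1 x2 x3 x4 : 'M[Cx R]_1) :
      ('i *: (x1 - 'i *: x2 + 'i *: (x3 - 'i *: x4))) 0 0 =
      'i * (x1 0 0 + x4 0 0) + (x2 0 0 - x3 0 0).
    rewrite !mxE; have := sqrCi (Cx R); rewrite expr2 => ii.
    have -> : 'i * (x1 0 0 - 'i * x2 0 0 + 'i * (x3 0 0 - 'i * x4 0 0)) =
      'i * x1 0 0 - ('i * 'i) * x2 0 0 + ('i * 'i) * x3 0 0 -
      ('i * 'i) * 'i * x4 0 0 by ring.
    rewrite ii; ring.
  have toCB (x y : R) :
      'i * (toC 0 + toC 0) + (toC x - toC y) = toC (x - y) :> Cx R.
    rewrite -complexiE; apply/eqP; rewrite eq_complex /=.
    by apply/andP; split; apply/eqP; ring.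
  have sesquilinear (x1 x2 x3 x4 : 'M[Cx R]_1) (s2 s3 : R) :
      x1 0 0 = toC 0 -> x2 0 0 = toC s2 -> x3 0 0 = toC s3 -> x4 0 0 = toC 0 ->
      ('i *: (x1 - 'i *: x2 + 'i *: (x3 - 'i *: x4))) 0 0 = toC (s2 - s3).
    by move=> e1 e2 e3 e4; rewrite entry e1 e2 e3 e4 toCB.
  exact: (sesquilinear _ _ _ _ _ _ (etrans (SC a a) (congr1 toC (S0 a)))
    (SC b a) (SC a b) (etrans (SC b b) (congr1 toC (S0 b)))).
congr toC; rewrite (SN a b) opprK -mulr2n.
have Dc (x y : 'rV[R]_n) : (y *m 'D_x c p) 0 0 =
    \sum_k \sum_j x 0 j * y 0 k * 'D_(delta_mx 0 j) c p k 0.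
  rewrite mxE; apply: eq_bigr => k _; rewrite derive_sum_partial // summxE.
  rewrite mulr_sumr; apply: eq_bigr => j _; rewrite mxE /partial.
  set t := 'D__ c p k 0; ring.
have entryB (x y : 'M[R]_1) : (x - y) 0 0 = x 0 0 - y 0 0 by rewrite !mxE.
apply: esym; apply: etrans (entryB _ _) _.
apply: etrans (congr2 (fun x y => x - y) (Dc b a) (Dc a b)) _.
rewrite [X in _ - X]exchange_big -sumrB.
rewrite /S mxE -sumrMnl; apply: eq_bigr => k _.
rewrite [(b *m T) 0 k]mxE [a^T k 0]mxE mulr_suml -sumrMnl -sumrB.
apply: eq_bigr => j _; rewrite [T j k]mxE.
have collect (x y r s : R) :
    x * y * r - y * x * s = x * (2^-1 * (r - s)) * y *+ 2.
  by rewrite -mulr_natr; field.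
exact: collect.
Qed.

(** * Second derivatives of sums, linear images and squared norms *)

Lemma Ck_id (R : realType) (V : normedModType R) (k : nat) (U : set V) :
  open U -> Ck k U (@id V).
Proof.
move=> oU; case: k => [|k]; first by apply/Ck0P => // p _; exact: cvg_id.
have dId (p : V) : differentiable (@id V) p by exact: ex_diff.
split=> // v; apply: Ck_eq (Ck_cst k v oU) => // p _.
by rewrite derive_id.
Qed.

Lemma CkB (R : realType) (V W : normedModType R) (k : nat) (U : set V)
    (f g : V -> W) : open U -> Ck k U f -> Ck k U g ->
  Ck k U (fun p => f p - g p).
Proof.
move=> oU Cf; elim: k f Cf g => [|k IH] f Cf g Cg.
  apply/Ck0P => // p Up; move/Ck0P: Cf => /(_ oU p Up) cf.
  move/Ck0P: Cg => /(_ oU p Up) cg; exact: cvgB.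
have [df Df] := Cf; have [dg Dg] := Cg; split=> [p Up|v].
  by apply: differentiableB; [exact: df|exact: dg].
apply: Ck_eq (IH _ (Df v) _ (Dg v)) => // p Up.
by rewrite deriveB //; apply: diff_derivable; [exact: df|exact: dg].
Qed.

Lemma derive2B (R : realType) (V W : normedModType R) (U : set V)
    (f g : V -> W) (p u v : V) : open U -> U p -> Ck 2 U f -> Ck 2 U g ->
  'D_u ('D_v (fun q => f q - g q)) p = 'D_u ('D_v f) p - 'D_u ('D_v g) p.
Proof.
move=> oU Up Cf Cg.
have df : differentiable ('D_v f) p := Ck_differentiable (Ck_derive v Cf) Up.
have dg : differentiable ('D_v g) p := Ck_differentiable (Ck_derive v Cg) Up.
apply: etrans _ (deriveB (diff_derivable (v := u) df) (diff_derivable dg)).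
apply: near_eq_derive; apply: near_open (Up) _ => // q Uq.
have dfq : differentiable f q := Ck_differentiable Cf Uq.
have dgq : differentiable g q := Ck_differentiable Cg Uq.
exact: (deriveB (diff_derivable (v := v) dfq) (diff_derivable dgq)).
Qed.

Lemma derive2D (R : realType) (V W : normedModType R) (U : set V)
    (f g : V -> W) (p u v : V) : open U -> U p -> Ck 2 U f -> Ck 2 U g ->
  'D_u ('D_v (fun q => f q + g q)) p = 'D_u ('D_v f) p + 'D_u ('D_v g) p.
Proof.
move=> oU Up Cf Cg.
have df : differentiable ('D_v f) p := Ck_differentiable (Ck_derive v Cf) Up.
have dg : differentiable ('D_v g) p := Ck_differentiable (Ck_derive v Cg) Up.
apply: etrans _ (deriveD (diff_derivable (v := u) df) (diff_derivable dg)).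
apply: near_eq_derive; apply: near_open (Up) _ => // q Uq.
have dfq : differentiable f q := Ck_differentiable Cf Uq.
have dgq : differentiable g q := Ck_differentiable Cg Uq.
exact: (deriveD (diff_derivable (v := v) dfq) (diff_derivable dgq)).
Qed.

Lemma derive2_cst (R : realType) (V W : normedModType R) (c : W) (p u v : V) :
  'D_u ('D_v (cst c)) p = 0.
Proof.
have -> : 'D_v (cst c) = cst 0 :> (V -> W).
  by apply/funext => q; rewrite derive_cst.
exact: derive_cst.
Qed.

Lemma derive2_id (R : realType) (V : normedModType R) (p u v : V) :
  'D_u ('D_v id) p = 0.
Proof.
have -> : 'D_v id = cst v by apply/funext => q; rewrite derive_id.
exact: derive_cst.
Qed.

Lemma derive_mulmxr (R : realType) (V : normedModType R) (a b c : nat)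
    (A : V -> 'M[R]_(a, b)) (L : 'M[R]_(b, c)) (p v : V) :
  differentiable A p -> 'D_v (fun q => A q *m L) p = 'D_v A p *m L.
Proof.
move=> dA; apply: etrans (derive_mulmx v dA (differentiable_cst L p)) _.
by rewrite derive_cst mulmx0 addr0.
Qed.

Lemma derive2_mulmxr (R : realType) (V : normedModType R) (a b c : nat)
    (U : set V) (A : V -> 'M[R]_(a, b)) (L : 'M[R]_(b, c)) (p u v : V) :
  open U -> U p -> Ck 2 U A ->
  'D_u ('D_v (fun q => A q *m L)) p = 'D_u ('D_v A) p *m L.
Proof.
move=> oU Up CA.
have dA : differentiable ('D_v A) p := Ck_differentiable (Ck_derive v CA) Up.
apply: etrans _ (derive_mulmxr L u dA).
apply: near_eq_derive; apply: near_open (Up) _ => // q Uq.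
exact: derive_mulmxr (Ck_differentiable CA Uq).
Qed.

Lemma derive2_sqr (R : realType) (V : normedModType R) (U : set V)
    (f : V -> R) (p v : V) : open U -> U p -> Ck 2 U f ->
  'D_v ('D_v (fun q => f q ^+ 2)) p =
  2 * (f p * 'D_v ('D_v f) p + ('D_v f p) ^+ 2).
Proof.
move=> oU Up Cf.
have df q : U q -> differentiable f q by exact: Ck_differentiable Cf.
have dDf : differentiable ('D_v f) p := Ck_differentiable (Ck_derive v Cf) Up.
have e1 q : U q -> 'D_v (fun q => f q ^+ 2) q = 2 *: (f q * 'D_v f q).
  move=> Uq; have dfv : derivable f q v := diff_derivable (df q Uq).
  apply: etrans (deriveM dfv dfv) _.
  by rewrite /GRing.scale /=; set x := 'D_v f q; ring.
apply: etrans (near_eq_derive v (near_open oU Up e1)) _.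
have d1 : derivable (f * 'D_v f) p v.
  by apply: derivableM; apply: diff_derivable => //; exact: df.
apply: etrans (deriveZ 2 d1) _; congr (_ * _).
apply: etrans (deriveM (diff_derivable (df p Up)) (diff_derivable dDf)) _.
by rewrite expr2.
Qed.

Lemma derive_sqr (R : realType) (V : normedModType R) (f : V -> R) (p v : V) :
  differentiable f p -> 'D_v (fun q => f q ^+ 2) p = 2 * (f p * 'D_v f p).
Proof.
move=> df; have dfv : derivable f p v := diff_derivable df.
apply: etrans (deriveM dfv dfv) _.
by rewrite /GRing.scale /=; set x := 'D_v f p; ring.
Qed.

(** The norm on row vectors is the sup norm, which is not differentiable; a penalty of class C^2
    needs the Euclidean square. *)
Definition sqnorm (R : realType) (n : nat) (x : 'rV[R]_n) : R :=
  \sum_l x 0 l ^+ 2.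

Lemma Ck_sqnorm (R : realType) (V : normedModType R) (n k : nat) (U : set V)
    (F : V -> 'rV[R]_n) : open U -> Ck k U F -> Ck k U (fun q => sqnorm (F q)).
Proof.
move=> oU /(Ck_mx _ _ oU) CF.
apply: (Ck_sum (index_enum 'I_n) oU) => l.
exact: Ck_eq oU _ (Ck_mul oU (CF 0 l) (CF 0 l)).
Qed.

Lemma derive_sqnorm (R : realType) (V : normedModType R) (n : nat)
    (F : V -> 'rV[R]_n) (p v : V) : differentiable F p ->
  'D_v (fun q => sqnorm (F q)) p = 2 * \sum_l F p 0 l * ('D_v F p) 0 l.
Proof.
move=> dF.
have dFl l : differentiable (fun q => F q 0 l) p by exact: differentiable_mxE.
have -> : (fun q => sqnorm (F q)) = \sum_l (fun q => F q 0 l ^+ 2).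
  by apply/funext => q; rewrite fct_sumE.
rewrite derive_sum; last first.
  by move=> l; apply: diff_derivable; exact: (differentiableM (dFl l) (dFl l)).
rewrite mulr_sumr; apply: eq_bigr => l _.
by rewrite derive_sqr // derive_mxE.
Qed.

Lemma derive2_sqnorm (R : realType) (V : normedModType R) (n : nat)
    (U : set V) (F : V -> 'rV[R]_n) (p v : V) : open U -> U p -> Ck 2 U F ->
  'D_v ('D_v (fun q => sqnorm (F q))) p =
  2 * (\sum_l F p 0 l * ('D_v ('D_v F) p) 0 l + sqnorm ('D_v F p)).
Proof.
move=> oU Up CF.
have CFl l : Ck 2 U (fun q => F q 0 l) by exact: ((Ck_mx _ _ oU).1 CF).
have CF2 l : Ck 2 U (fun q => F q 0 l ^+ 2).
  exact: Ck_eq oU _ (Ck_mul oU (CFl l) (CFl l)).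
have e1 q : U q -> 'D_v (fun q => sqnorm (F q)) q =
    (\sum_l 'D_v (fun q => F q 0 l ^+ 2)) q.
  move=> Uq; have -> : (fun q => sqnorm (F q)) = \sum_l (fun q => F q 0 l ^+ 2).
    by apply/funext => q'; rewrite fct_sumE.
  rewrite derive_sum ?fct_sumE // => l; apply: diff_derivable.
  exact: Ck_differentiable (CF2 l) Uq.
apply: etrans (near_eq_derive v (near_open oU Up e1)) _.
rewrite derive_sum; last first.
  move=> l; apply: diff_derivable.
  exact: Ck_differentiable (Ck_derive v (CF2 l)) Up.
rewrite /sqnorm -big_split mulr_sumr; apply: eq_bigr => l _.
apply: etrans (derive2_sqr v oU Up (CFl l)) _.
have -> := derive_mxE v 0 l (Ck_differentiable CF Up).
by have -> := derive2_mxE v v 0 l oU Up CF.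
Qed.

(** * The penalized test function and its Levi form *)

Section TestFunction.
Context (R : realType) (m n : nat) (U' : set 'rV[R]_m)
  (f : 'rV[R]_m -> 'rV[R]_n) (phi : 'rV[R]_m -> R) (p : 'rV[R]_m)
  (z : 'rV[R]_n) (L : 'M[R]_(n, m)) (k : R).
Context (oU' : open U') (U'p : U' p) (Cf : Ck 2 U' f) (Cphi : Ck 2 U' phi).
Context (fL : jacobian f p *m L = 1%:M).

Let df : differentiable f p := Ck_differentiable Cf U'p.

(** The affine first guess [p + (x - z) L]. Matrices act on the right, so [Df(p) L = 1] makes [L] a
    left inverse of the differential of [f] at [p]. *)
Let alpha (x : 'rV[R]_n) : 'rV[R]_m := x *m L - (z *m L - p).

(* To second order at [z], a left inverse of [f] composed with a projection onto
   its image: a Newton step replaces the inverse function theorem. *)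
Definition retraction (x : 'rV[R]_n) : 'rV[R]_m :=
  alpha x - ((f (alpha x) - f p) *m L - (alpha x - p)).

Definition defect (x : 'rV[R]_n) : 'rV[R]_n := x - f (retraction x).

Definition penalized (x : 'rV[R]_n) : R :=
  phi (retraction x) + k * sqnorm (defect x).

Let alphaz : alpha z = p.
Proof. by rewrite /alpha subKr. Qed.

Lemma retractionz : retraction z = p.
Proof. by rewrite /retraction alphaz !subrr mul0mx !subr0. Qed.

Let N1 := alpha @^-1` U'.
Definition test_dom : set 'rV[R]_n := N1 `&` retraction @^-1` U'.

Let Calpha (l : nat) : Ck l setT alpha.
Proof.
apply: CkB; [exact: openT| |exact: (Ck_cst _ _ openT)].
apply: (Ck_mulmx (A := id) (B := cst L) openT).
  exact: (Ck_id _ openT).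
exact: (Ck_cst _ _ openT).
Qed.

Let oN1 : open N1.
Proof.
apply: open_comp => // x _; exact: (Ck_continuous openT (Calpha 0)).
Qed.

Let Cfalpha : Ck 2 N1 (f \o alpha).
Proof.
apply: Ck_comp oN1 oU' _ _ Cf => //.
exact: Ck_subset openT oN1 (@subsetT _ _) (Calpha 2).
Qed.

Let Calpha1 : Ck 2 N1 alpha.
Proof. exact: Ck_subset openT oN1 (@subsetT _ _) (Calpha 2). Qed.

Let Cret1 : Ck 2 N1 retraction.
Proof.
apply: CkB (oN1) Calpha1 _; apply: CkB (oN1) _ _.
  apply: (Ck_mulmx (A := fun x => f (alpha x) - f p) (B := cst L) oN1).
    exact: CkB oN1 Cfalpha (Ck_cst 2 (f p) oN1).
  exact: (Ck_cst _ _ oN1).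
exact: CkB oN1 Calpha1 (Ck_cst 2 p oN1).
Qed.

Lemma open_test_dom : open test_dom.
Proof.
have := oN1; rewrite !openE => oN x [N1x U'x].
apply: filterI; first exact: oN.
have cr : {for x, continuous retraction} by exact: Ck_continuous oN1 Cret1 N1x.
by apply: cr; apply: open_nbhs_nbhs; split.
Qed.

Lemma test_domz : test_dom z.
Proof. by split; rewrite /N1 /= ?alphaz ?retractionz. Qed.

Let sub : test_dom `<=` N1. Proof. by move=> x []. Qed.

Lemma Ck_retraction : Ck 2 test_dom retraction.
Proof. exact: Ck_subset oN1 open_test_dom sub Cret1. Qed.

Lemma test_dom_retraction x : test_dom x -> U' (retraction x).
Proof. by case. Qed.

Let Cfret : Ck 2 test_dom (f \o retraction).
Proof.
exact: Ck_comp open_test_dom oU' test_dom_retraction Ck_retraction Cf.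
Qed.

Let Cphiret : Ck 2 test_dom (phi \o retraction).
Proof.
exact: Ck_comp_real open_test_dom oU' test_dom_retraction Ck_retraction Cphi.
Qed.

Lemma Ck_defect : Ck 2 test_dom defect.
Proof. exact: CkB open_test_dom (Ck_id 2 open_test_dom) Cfret. Qed.

Lemma Ck_penalized : Ck 2 test_dom penalized.
Proof.
apply: CkD open_test_dom Cphiret _.
apply: (Ck_mul (f := cst k) open_test_dom (Ck_cst 2 k open_test_dom)).
exact: Ck_sqnorm open_test_dom Ck_defect.
Qed.

Let calpha : 'rV[R]_m := z *m L - p.

Let derive_alpha v x : 'D_v alpha x = v *m L.
Proof.
have did : differentiable (@id 'rV[R]_n) x by exact: ex_diff.
have dL : differentiable (fun y : 'rV[R]_n => y *m L) x.
  exact: Ck_differentiable (Ck_mulmx openT (Ck_id 1 openT) (Ck_cst 1 L openT)) I.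
apply: etrans (deriveB (diff_derivable (v := v) dL) (derivable_cst calpha x v)) _.
apply: etrans (congr1 (fun y => y - _) (derive_mulmxr L v did)) _.
by rewrite derive_cst derive_id subr0.
Qed.

Let derive2_alpha v x : 'D_v ('D_v alpha) x = 0.
Proof.
have -> : 'D_v alpha = cst (v *m L) by apply/funext => y; exact: derive_alpha.
exact: derive_cst.
Qed.

Let q v : 'rV[R]_n := 'D_(v *m L) ('D_(v *m L) f) p.
Let D := jacobian f p.

Let N1z : N1 z. Proof. by rewrite /N1 /= alphaz. Qed.

Let derive_falpha v : 'D_v (f \o alpha) z = v *m L *m D.
Proof.
have da : differentiable alpha z := Ck_differentiable (Calpha 1) I.
have dfa : differentiable f (alpha z) by rewrite alphaz.
by rewrite (derive_comp v da dfa) alphaz derive_alpha deriveEjacobian.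
Qed.

Let derive2_falpha v : 'D_v ('D_v (f \o alpha)) z = q v.
Proof.
have aU x : N1 x -> U' (alpha x) by [].
apply: etrans (derive2_comp_mx v v oN1 oU' aU N1z Calpha1 Cf) _.
by rewrite derive2_alpha derive_alpha alphaz derive0 add0r.
Qed.

Let Cf1 : Ck 2 N1 (fun x => f (alpha x) - f p).
Proof. exact: CkB oN1 Cfalpha (Ck_cst 2 (f p) oN1). Qed.

Let Cf2 : Ck 2 N1 (fun x => (f (alpha x) - f p) *m L).
Proof. exact: (Ck_mulmx oN1 Cf1 (Ck_cst 2 L oN1)). Qed.

Let Ca1 : Ck 2 N1 (fun x => alpha x - p).
Proof. exact: CkB oN1 Calpha1 (Ck_cst 2 p oN1). Qed.

Let Cfa : Ck 2 N1 (fun x => (f (alpha x) - f p) *m L - (alpha x - p)).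
Proof. exact: CkB oN1 Cf2 Ca1. Qed.

Lemma derive_retraction v : 'D_v retraction z = v *m L.
Proof.
have d (F : 'rV[R]_n -> 'rV[R]_m) : Ck 2 N1 F -> derivable F z v.
  by move=> CF; exact: diff_derivable (Ck_differentiable CF N1z).
have dfa : derivable (f \o alpha) z v.
  exact: diff_derivable (Ck_differentiable Cfalpha N1z).
have e1 : 'D_v (fun x => f (alpha x) - f p) z = v *m L *m D.
  apply: etrans (deriveB dfa (derivable_cst (f p) z v)) _.
  by rewrite derive_cst subr0; exact: derive_falpha.
have e2 : 'D_v (fun x => (f (alpha x) - f p) *m L) z = v *m L.
  apply: etrans (derive_mulmxr L v (Ck_differentiable Cf1 N1z)) _.
  apply: etrans (congr1 (mulmx^~ L) e1) _.
  have DLK (x : 'rV[R]_m) : x *m D *m L = x by rewrite -mulmxA fL mulmx1.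
  exact: DLK.
have e3 : 'D_v (fun x => alpha x - p) z = v *m L.
  apply: etrans (deriveB (d _ Calpha1) (derivable_cst p z v)) _.
  by rewrite derive_cst subr0; exact: derive_alpha.
apply: etrans (deriveB (d _ Calpha1) (d _ Cfa)) _.
apply: etrans (congr2 (fun x y => x - y) (derive_alpha v z)
  (deriveB (d _ Cf2) (d _ Ca1))) _.
apply: etrans (congr2 (fun x y => _ - (x - y)) e2 e3) _.
by rewrite subrr subr0.
Qed.

(** The affine guess alone would give 0. The Newton correction contributes [- q L], which turns the
    second derivative [q] of [f] along the guess into [q - q L D], its part transverse to the image.
    The same term [- q L] also enters the Levi form of [phi \o retraction], where it is needed for
    the limit to be the Levi form of [phi]. *)
Lemma derive2_retraction v : 'D_v ('D_v retraction) z = - (q v *m L).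
Proof.
have C0 (W : normedModType R) (c : W) : Ck 2 N1 (cst c) by exact: Ck_cst.
pose g : 'rV[R]_n -> 'rV[R]_n := fun x => f (alpha x) - f p.
have Cg : Ck 2 N1 g := Cf1.
have e1 : 'D_v ('D_v g) z = q v.
  apply: etrans (derive2B v v oN1 N1z Cfalpha (C0 _ (f p))) _.
  apply: etrans (congr2 (fun x y => x - y) (derive2_falpha v)
    (derive2_cst (f p) z v v)) _; exact: subr0.
have e2 : 'D_v ('D_v (fun x => g x *m L)) z = q v *m L.
  apply: etrans (derive2_mulmxr L v v oN1 N1z Cg) _.
  exact: (congr1 (fun y : 'rV[R]_n => y *m L) e1).
have e3 : 'D_v ('D_v (fun x => alpha x - p)) z = 0.
  apply: etrans (derive2B v v oN1 N1z Calpha1 (C0 _ p)) _.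
  apply: etrans (congr2 (fun x y => x - y) (derive2_alpha v z)
    (derive2_cst p z v v)) _; exact: subr0.
apply: etrans (derive2B v v oN1 N1z Calpha1 Cfa) _.
apply: etrans (congr2 (fun x y => x - y) (derive2_alpha v z)
  (derive2B v v oN1 N1z Cf2 Ca1)) _.
apply: etrans (congr2 (fun x y => _ - (x - y)) e2 e3) _.
by rewrite subr0 sub0r.
Qed.

Let tz : test_dom z. Proof. exact: test_domz. Qed.

Let derive_fret v : 'D_v (f \o retraction) z = v *m L *m D.
Proof.
have dr : differentiable retraction z := Ck_differentiable Ck_retraction tz.
have dfr : differentiable f (retraction z) by rewrite retractionz.
by rewrite (derive_comp v dr dfr) retractionz derive_retraction deriveEjacobian.
Qed.

Let derive2_fret v : 'D_v ('D_v (f \o retraction)) z = q v - q v *m L *m D.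
Proof.
apply: etrans (derive2_comp_mx v v open_test_dom oU' test_dom_retraction tz
  Ck_retraction Cf) _.
rewrite derive2_retraction derive_retraction retractionz.
by rewrite (deriveNdir _ df) deriveEjacobian // addrC.
Qed.

Lemma derive_defect v : 'D_v defect z = v - v *m L *m D.
Proof.
have dr : differentiable (f \o retraction) z := Ck_differentiable Cfret tz.
have did : differentiable (@id 'rV[R]_n) z by exact: ex_diff.
apply: etrans (deriveB (diff_derivable (v := v) did) (diff_derivable dr)) _.
by rewrite derive_id derive_fret.
Qed.

Lemma derive2_defect v : 'D_v ('D_v defect) z = q v *m L *m D - q v.
Proof.
apply: etrans (derive2B v v open_test_dom tz (Ck_id 2 open_test_dom) Cfret) _.
by rewrite derive2_id derive2_fret sub0r opprB.
Qed.

Let dphi : differentiable phi p := Ck_differentiable Cphi U'p.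

Lemma derive_penalized v : 'D_v penalized z = 'D_(v *m L) phi p +
  k * (2 * \sum_l (z - f p) 0 l * (v - v *m L *m D) 0 l).
Proof.
have ddef : differentiable defect z := Ck_differentiable Ck_defect tz.
have dsq : derivable (fun x => sqnorm (defect x)) z v.
  apply: diff_derivable.
  exact: Ck_differentiable (Ck_sqnorm open_test_dom Ck_defect) tz.
have dr : differentiable retraction z := Ck_differentiable Ck_retraction tz.
have dphir : differentiable phi (retraction z) by rewrite retractionz.
have dpr : derivable (phi \o retraction) z v.
  exact: diff_derivable (Ck_differentiable Cphiret tz).
apply: etrans (deriveD dpr (derivableZ (k := k) dsq)) _.
congr (_ + _).
  by rewrite (derive_comp v dr dphir) retractionz derive_retraction.
apply: etrans (deriveZ k dsq) _; congr (_ * _).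
by rewrite (derive_sqnorm v ddef) derive_defect {1}/defect retractionz.
Qed.

Lemma derive2_penalized v : 'D_v ('D_v penalized) z =
  'D_(v *m L) ('D_(v *m L) phi) p - 'D_(q v *m L) phi p +
  k * (2 * (\sum_l (z - f p) 0 l * (q v *m L *m D - q v) 0 l +
            sqnorm (v - v *m L *m D))).
Proof.
have Csq := Ck_sqnorm open_test_dom Ck_defect.
have Cksq : Ck 2 test_dom (fun x => k * sqnorm (defect x)).
  exact: (Ck_mul (f := cst k) open_test_dom (Ck_cst 2 k open_test_dom) Csq).
apply: etrans (derive2D v v open_test_dom tz Cphiret Cksq) _; congr (_ + _).
  apply: etrans (derive2_comp v v open_test_dom oU' test_dom_retraction tz
    Ck_retraction Cphi) _.
  rewrite derive2_retraction derive_retraction retractionz.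
  by rewrite (deriveNdir _ dphi) addrC.
have dsq : derivable ('D_v (fun x => sqnorm (defect x))) z v.
  by apply: diff_derivable; exact: Ck_differentiable (Ck_derive v Csq) tz.
have e1 x : test_dom x -> 'D_v (fun x => k * sqnorm (defect x)) x =
    (k *: 'D_v (fun x => sqnorm (defect x))) x.
  move=> tx; have dx := Ck_differentiable Csq tx.
  by apply: deriveZ; exact: diff_derivable.
apply: etrans (near_eq_derive v (near_open open_test_dom tz e1)) _.
apply: etrans (deriveZ k dsq) _; congr (_ * _).
rewrite (derive2_sqnorm v open_test_dom tz Ck_defect) derive2_defect.
by rewrite derive_defect {1}/defect retractionz.
Qed.

(** The vector [s] gathers all first-order terms: [levi_dir] from [J] and [- q] from the curvature
    of the image. The map [x |-> x L D] is a projection onto the image of [D], so the factor of [k]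
    involves only the transverse parts of [s], [A] and [B]. The other terms are the Levi form of
    [phi] once [s L] is recognised as [levi_dir] for [J']. *)
Lemma levi_penalized (J : 'rV[R]_n -> 'M[R]_n) (A : 'rV[R]_n) :
  let B := A *m J z in
  let s := levi_dir J A z - q A - q B in
  levi J A penalized z =
  'D_(A *m L) ('D_(A *m L) phi) p + 'D_(B *m L) ('D_(B *m L) phi) p +
  'D_(s *m L) phi p +
  k * (2 * (\sum_l (z - f p) 0 l * (s - s *m L *m D) 0 l +
            sqnorm (A - A *m L *m D) + sqnorm (B - B *m L *m D))).
Proof.
move=> B s.
apply: etrans (congr2 +%R (congr2 +%R (derive2_penalized A)
  (derive2_penalized B)) (derive_penalized _)) _.
rewrite -/D; set g := levi_dir J A z.
have -> : 'D_(s *m L) phi p =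
    'D_(g *m L) phi p - 'D_(q A *m L) phi p - 'D_(q B *m L) phi p.
  rewrite /s !mulmxBl (deriveDdir _ _ dphi) (deriveNdir _ dphi).
  by rewrite (deriveDdir _ _ dphi) (deriveNdir _ dphi).
have -> : \sum_l (z - f p) 0 l * (s - s *m L *m D) 0 l =
    \sum_l (z - f p) 0 l * (g - g *m L *m D) 0 l +
    \sum_l (z - f p) 0 l * (q A *m L *m D - q A) 0 l +
    \sum_l (z - f p) 0 l * (q B *m L *m D - q B) 0 l.
  rewrite -!big_split; apply: eq_bigr => l _ /=; rewrite -!mulrDr.
  congr (_ * _); rewrite /s !mulmxBl.
  have collect (x1 x2 x3 x4 x5 x6 : 'rV[R]_n) :
      (x1 - x2 - x3 - (x4 - x5 - x6)) 0 l =
      (x1 - x4) 0 l + (x5 - x2) 0 l + (x6 - x3) 0 l.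
    by rewrite !mxE; ring.
  exact: collect.
have collect (a1 a2 a3 b1 b2 c1 s1 s2 s3 t1 t2 : R) :
    a1 - a2 + k * (2 * (s2 + t1)) + (b1 - b2 + k * (2 * (s3 + t2))) +
    (c1 + k * (2 * s1)) =
    a1 + b1 + (c1 - a2 - b2) + k * (2 * (s1 + s2 + s3 + t1 + t2)).
  by ring.
exact: collect.
Qed.

End TestFunction.

(** * Continuous right inverses, and functions of [(z, p)] compared with their values on the
    graph *)

Lemma continuous_sum (R : realType) (T : topologicalType) (I : Type)
    (r : seq I) (F : I -> T -> R) (x : T) :
  (forall i, {for x, continuous (F i)}) ->
  {for x, continuous (fun y => \sum_(i <- r) F i y)}.
Proof.
move=> cF; elim: r => [|i r IH].
  have -> : (fun y => \sum_(i <- [::]) F i y) = cst 0.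
    by apply/funext => y; rewrite big_nil.
  exact: cst_continuous.
have -> : (fun y => \sum_(j <- i :: r) F j y) =
    (fun y => F i y + \sum_(j <- r) F j y).
  by apply/funext => y; rewrite big_cons.
by apply: cvgD; [exact: cF|exact: IH].
Qed.

Lemma continuous_prod (R : realType) (T : topologicalType) (I : Type)
    (r : seq I) (F : I -> T -> R) (x : T) :
  (forall i, {for x, continuous (F i)}) ->
  {for x, continuous (fun y => \prod_(i <- r) F i y)}.
Proof.
move=> cF; elim: r => [|i r IH].
  have -> : (fun y => \prod_(i <- [::]) F i y) = cst 1.
    by apply/funext => y; rewrite big_nil.
  exact: cst_continuous.
have -> : (fun y => \prod_(j <- i :: r) F j y) =
    (fun y => F i y * \prod_(j <- r) F j y).
  by apply/funext => y; rewrite big_cons.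
by apply: cvgM; [exact: cF|exact: IH].
Qed.

Lemma continuous_det (R : realType) (T : topologicalType) (m : nat)
    (M : T -> 'M[R]_m) (x : T) :
  (forall i j, {for x, continuous (fun y => M y i j)}) ->
  {for x, continuous (fun y => \det (M y))}.
Proof.
move=> cM; apply: continuous_sum => s; apply: cvgM; first exact: cst_continuous.
by apply: continuous_prod => i; exact: cM.
Qed.

Lemma continuous_adj (R : realType) (T : topologicalType) (m : nat)
    (M : T -> 'M[R]_m) (x : T) i j :
  (forall i j, {for x, continuous (fun y => M y i j)}) ->
  {for x, continuous (fun y => (\adj (M y)) i j)}.
Proof.
move=> cM; have -> : (fun y => (\adj (M y)) i j) =
    (fun y => (-1) ^+ (j + i) * \det (row' j (col' i (M y)))).
  by apply/funext => y; rewrite mxE.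
have cdet : {for x, continuous (fun y => \det (row' j (col' i (M y))))}.
  apply: (continuous_det (M := fun y => row' j (col' i (M y)))) => a b.
  have -> : (fun y => row' j (col' i (M y)) a b) =
      (fun y => M y (lift j a) (lift i b)).
    by apply/funext => y; rewrite !mxE.
  exact: cM.
by apply: cvgM; [exact: cst_continuous|exact: cdet].
Qed.

(** A fixed right inverse [L0] of [D x] is corrected by the inverse of [D y L0], which equals 1 at
    [x] and whose inverse is continuous by Cramer's formula. *)
Lemma continuous_right_inverse (R : realType) (T : topologicalType)
    (m n : nat) (D : T -> 'M[R]_(m, n)) (x : T) :
  (forall i j, {for x, continuous (fun y => D y i j)}) -> row_free (D x) ->
  exists L : T -> 'M[R]_(n, m),
    (forall i j, {for x, continuous (fun y => L y i j)}) /\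
    \forall y \near x, D y *m L y = 1%:M.
Proof.
move=> cD /row_freeP[L0 DL0].
pose M y := D y *m L0.
have cM i j : {for x, continuous (fun y => M y i j)}.
  have -> : (fun y => M y i j) = (fun y => \sum_k D y i k * L0 k j).
    by apply/funext => y; rewrite mxE.
  apply: continuous_sum => k.
  by apply: cvgM; [exact: cD|exact: cst_continuous].
have cdet := continuous_det cM.
have det1 : \det (M x) = 1 by rewrite /M DL0 det1.
exists (fun y => L0 *m ((\det (M y))^-1 *: \adj (M y))); split.
  move=> i j; have -> : (fun y => (L0 *m ((\det (M y))^-1 *: \adj (M y))) i j) =
      (fun y => \sum_k L0 i k * ((\det (M y))^-1 * (\adj (M y)) k j)).
    by apply/funext => y; rewrite mxE; apply: eq_bigr => k _; rewrite mxE.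
  apply: continuous_sum => k; apply: cvgM; first exact: cst_continuous.
  apply: cvgM; last exact: continuous_adj.
  by apply: cvgV => //; rewrite det1 oner_neq0.
have : \forall y \near x, `|\det (M x) - \det (M y)| < 1.
  by move/cvgrPdist_lt : cdet => /(_ 1 ltr01).
apply: filterS => y; rewrite det1 => dy.
have dn0 : \det (M y) != 0.
  by apply: contraTneq dy => ->; rewrite subr0 normr1 ltxx.
by rewrite mulmxA -scalemxAr mul_mx_adj scale_scalar_mx mulVf.
Qed.

(* If [g] moreover vanishes on the graph of [f], then [g (z, p)] is
   [O(|z - f p|)] near [(f p0, p0)]. *)
Definition lip_along (R : realType) (m n : nat) (f : 'rV[R]_m -> 'rV[R]_n)
    (p0 : 'rV[R]_m) (g : 'rV[R]_n * 'rV[R]_m -> R) : Prop :=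
  {for (f p0, p0), continuous g} /\
  exists C : R, \forall q \near (f p0, p0),
    `|g q - g (f q.2, q.2)| <= C * `|q.1 - f q.2|.

Definition lip_along_mx (R : realType) (m n a b : nat)
    (f : 'rV[R]_m -> 'rV[R]_n) (p0 : 'rV[R]_m)
    (g : 'rV[R]_n * 'rV[R]_m -> 'M[R]_(a, b)) : Prop :=
  forall i j, lip_along f p0 (fun q => g q i j).

Section LipAlong.
Context (R : realType) (m n : nat) (f : 'rV[R]_m -> 'rV[R]_n)
  (p0 : 'rV[R]_m) (cf : {for p0, continuous f}).

Lemma near_fst (T1 T2 : topologicalType) (x : T1) (y : T2) (P : T1 -> Prop) :
  (\forall z \near x, P z) -> \forall q \near (x, y), P q.1.
Proof. exact: cvg_fst. Qed.

Lemma near_snd (T1 T2 : topologicalType) (x : T1) (y : T2) (P : T2 -> Prop) :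
  (\forall z \near y, P z) -> \forall q \near (x, y), P q.2.
Proof. exact: cvg_snd. Qed.

Lemma near_graph (P : 'rV[R]_n * 'rV[R]_m -> Prop) :
  (\forall q \near (f p0, p0), P q) -> \forall q \near (f p0, p0), P (f q.2, q.2).
Proof.
move=> [[A B] /= [nA nB] AB].
have Pp : \forall p \near p0, P (f p, p).
  have nfA : \forall p \near p0, A (f p) by exact: cf.
  by apply: filterS (filterI nfA nB) => p [Ap Bp]; exact: (AB (f p, p)).
exact: (near_snd (f p0) Pp).
Qed.

Lemma lip_along_eq g h : (\forall q \near (f p0, p0), g q = h q) ->
  lip_along f p0 g -> lip_along f p0 h.
Proof.
move=> gh [cg [C gC]]; split.
  rewrite /prop_for /continuous_at -(nbhs_singleton gh).
  by apply: cvg_trans cg; apply: near_eq_cvg.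
exists C; apply: filterS (filterI gh (filterI (near_graph gh) gC)) => q [gq [gq' gCq]].
by rewrite -gq -gq'.
Qed.

(** The comparison point [(f p, p)] keeps the same [p], so continuity is enough. This admits [L] and
    the second derivatives of [f] and [phi], which are merely continuous. *)
Lemma lip_along_snd (h : 'rV[R]_m -> R) : {for p0, continuous h} ->
  lip_along f p0 (fun q => h q.2).
Proof.
move=> ch; split; first by move=> A /ch; exact: near_snd.
exists 0; apply: filterE => q /=; by rewrite subrr normr0 mul0r.
Qed.

Lemma lip_along_fst (U : set 'rV[R]_n) (g : 'rV[R]_n -> R) : open U ->
  U (f p0) -> Ck 1 U g -> lip_along f p0 (fun q => g q.1).
Proof.
move=> oU Up Cg; split.
  by move=> A /(Ck_continuous oU Cg Up); exact: near_fst.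
have [C [r [C0 r0 gC]]] := Ck1_lipschitz oU Up Cg; exists C.
have B1 : \forall q \near (f p0, p0), ball (f p0) r q.1.
  by apply: near_fst; exact: nbhsx_ballx.
by apply: filterS (filterI B1 (near_graph B1)) => q [q1 q2]; exact: gC.
Qed.

Lemma lip_along_cst (c : R) : lip_along f p0 (fun=> c).
Proof. by apply: lip_along_snd; exact: cst_continuous. Qed.

Lemma lip_alongD g h : lip_along f p0 g -> lip_along f p0 h ->
  lip_along f p0 (fun q => g q + h q).
Proof.
move=> [cg [C gC]] [ch [C' hC]]; split; first exact: cvgD.
exists (C + C'); apply: filterS (filterI gC hC) => q [gq hq].
have -> : g q + h q - (g (f q.2, q.2) + h (f q.2, q.2)) =
  g q - g (f q.2, q.2) + (h q - h (f q.2, q.2)) by ring.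
by rewrite mulrDl (le_trans (ler_normD _ _)) // lerD.
Qed.

Lemma lip_alongM g h : lip_along f p0 g -> lip_along f p0 h ->
  lip_along f p0 (fun q => g q * h q).
Proof.
move=> [cg [C gC]] [ch [C' hC]]; split; first exact: cvgM.
have bounded (k : 'rV[R]_n * 'rV[R]_m -> R) : {for (f p0, p0), continuous k} ->
    \forall q \near (f p0, p0), `|k q| <= `|k (f p0, p0)| + 1.
  move/cvgrPdist_lt => /(_ 1 ltr01); apply: filterS => q; rewrite distrC => kq.
  have := le_lt_trans (ler_dist_dist _ _) kq.
  by rewrite ltr_norml => /andP[_ ?]; lra.
have bg := bounded _ cg; have bh := near_graph (bounded _ ch).
exists (C * (`|h (f p0, p0)| + 1) + (`|g (f p0, p0)| + 1) * C').
apply: filterS (filterI (filterI gC hC) (filterI bg bh)) => q [[gq hq] [bgq bhq]].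
have -> : g q * h q - g (f q.2, q.2) * h (f q.2, q.2) =
  (g q - g (f q.2, q.2)) * h (f q.2, q.2) + g q * (h q - h (f q.2, q.2)) by ring.
apply: le_trans (ler_normD _ _) _; rewrite !normrM [leRHS]mulrDl; apply: lerD.
  by rewrite mulrAC ler_pM.
by rewrite -mulrA ler_pM.
Qed.

Lemma lip_alongB g h : lip_along f p0 g -> lip_along f p0 h ->
  lip_along f p0 (fun q => g q - h q).
Proof.
move=> lg lh; have := lip_alongD lg (lip_alongM (lip_along_cst (-1)) lh).
by apply: lip_along_eq; apply: filterE => q; rewrite mulN1r.
Qed.

Lemma lip_along_sum (I : Type) (r : seq I) (g : I -> _ -> R) :
  (forall i, lip_along f p0 (g i)) ->
  lip_along f p0 (fun q => \sum_(i <- r) g i q).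
Proof.
move=> lg; elim: r => [|i r IH].
  apply: lip_along_eq (lip_along_cst 0).
  by apply: filterE => q; rewrite big_nil.
apply: lip_along_eq (lip_alongD (lg i) IH).
by apply: filterE => q; rewrite big_cons.
Qed.

Lemma lip_along_mulmx (a b c : nat) (A : _ -> 'M[R]_(a, b))
    (B : _ -> 'M[R]_(b, c)) : lip_along_mx f p0 A -> lip_along_mx f p0 B ->
  lip_along_mx f p0 (fun q => A q *m B q).
Proof.
move=> lA lB i j.
apply: lip_along_eq (lip_along_sum (index_enum 'I_b)
  (fun k => lip_alongM (lA i k) (lB k j))).
by apply: filterE => q; rewrite mxE.
Qed.

Lemma lip_along_mxB (a b : nat) (A B : _ -> 'M[R]_(a, b)) :
  lip_along_mx f p0 A -> lip_along_mx f p0 B ->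
  lip_along_mx f p0 (fun q => A q - B q).
Proof.
move=> lA lB i j; apply: lip_along_eq (lip_alongB (lA i j) (lB i j)).
by apply: filterE => q; rewrite !mxE.
Qed.

Lemma lip_along_small g : lip_along f p0 g ->
  (\forall p \near p0, g (f p, p) = 0) ->
  exists C : R, \forall q \near (f p0, p0), `|g q| <= C * `|q.1 - f q.2|.
Proof.
move=> [_ [C gC]] g0; exists C.
have {}g0 := near_snd (f p0) g0.
by apply: filterS (filterI gC g0) => q [+ g0q]; rewrite g0q subr0.
Qed.

Lemma lip_along_mx_small (a b : nat) (A : _ -> 'M[R]_(a, b)) :
  lip_along_mx f p0 A -> (\forall p \near p0, A (f p, p) = 0) ->
  exists2 C : R, 0 <= C &
    \forall q \near (f p0, p0), forall i j, `|A q i j| <= C * `|q.1 - f q.2|.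
Proof.
move=> lA A0.
have small i j : exists C : R,
    \forall q \near (f p0, p0), `|A q i j| <= C * `|q.1 - f q.2|.
  apply: (lip_along_small (lA i j)); apply: filterS A0 => p ->; exact: mxE.
pose C ij := sval (cid (small ij.1 ij.2)).
have CP ij : \forall q \near (f p0, p0), `|A q ij.1 ij.2| <= C ij * `|q.1 - f q.2|.
  exact: svalP (cid (small ij.1 ij.2)).
exists (\sum_ij `|C ij|); first by apply: sumr_ge0.
have CPall : \forall q \near (f p0, p0), forall ij, `|A q ij.1 ij.2| <= C ij * `|q.1 - f q.2|.
  exact: filter_forall CP.
apply: filterS CPall => q Cq i j.
apply: le_trans (Cq (i, j)) _; rewrite ler_wpM2r // (le_trans (ler_norm _)) //.
by rewrite (bigD1 (i, j)) //= lerDl sumr_ge0.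
Qed.

Section Derivatives.
Context (U : set 'rV[R]_n) (U' : set 'rV[R]_m) (oU : open U) (oU' : open U')
  (Up : U (f p0)) (U'p : U' p0).

Lemma lip_along_mx_fst (a b : nat) (A : 'rV[R]_n -> 'M[R]_(a, b)) :
  Ck 1 U A -> lip_along_mx f p0 (fun q => A q.1).
Proof. by move=> /(Ck_mx _ _ oU) CA i j; exact: lip_along_fst oU Up (CA i j). Qed.

Lemma lip_along_mx_snd (a b k : nat) (A : 'rV[R]_m -> 'M[R]_(a, b)) :
  Ck k U' A -> lip_along_mx f p0 (fun q => A q.2).
Proof.
move=> /(Ck_mx _ _ oU') CA i j; apply: (lip_along_snd (h := fun p => A p i j)).
exact: Ck_continuous oU' (CA i j) U'p.
Qed.

(** The partial derivatives of [A] are taken at the point [z] that leaves the graph, so they have to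
    be Lipschitz, whence [Ck 2]. Expanding in partial derivatives separates them from the moving
    direction [v]. *)
Lemma lip_along_derive_fst (a b : nat) (A : 'rV[R]_n -> 'M[R]_(a, b))
    (v : _ -> 'rV[R]_n) : Ck 2 U A -> lip_along_mx f p0 v ->
  lip_along_mx f p0 (fun q => 'D_(v q) A q.1).
Proof.
move=> CA lv i j.
have lD k := lip_along_mx_fst (Ck_derive (delta_mx 0 k) CA).
apply: lip_along_eq (lip_along_sum (index_enum 'I_n)
  (fun k => lip_alongM (lv 0 k) (lD k i j))).
apply: filterS (near_fst p0 (open_nbhs_nbhs (conj oU Up))) => q Uq.
rewrite (derive_sum_partial _ (Ck_differentiable CA Uq)) summxE.
by apply: eq_bigr => k _; rewrite mxE.
Qed.

Lemma lip_along_derive_snd (g : 'rV[R]_m -> R) (v : _ -> 'rV[R]_m) :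
  Ck 1 U' g -> lip_along_mx f p0 v ->
  lip_along f p0 (fun q => 'D_(v q) g q.2).
Proof.
move=> Cg lv.
have lD k : lip_along f p0 (fun q => partial k g q.2).
  apply: lip_along_snd; exact: Ck_continuous oU' (Ck_derive _ Cg) U'p.
apply: lip_along_eq (lip_along_sum (index_enum 'I_m)
  (fun k => lip_alongM (lv 0 k) (lD k))).
apply: filterS (near_snd (f p0) (open_nbhs_nbhs (conj oU' U'p))) => q Uq.
by rewrite (derive_sum_partial _ (Ck_differentiable Cg Uq)).
Qed.

Lemma lip_along_derive2_snd (g : 'rV[R]_m -> R) (v : _ -> 'rV[R]_m) :
  Ck 2 U' g -> lip_along_mx f p0 v ->
  lip_along f p0 (fun q => 'D_(v q) ('D_(v q) g) q.2).
Proof.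
move=> Cg lv.
have lD k := lip_along_derive_snd (Ck_derive (delta_mx 0 k) Cg) lv.
apply: lip_along_eq (lip_along_sum (index_enum 'I_m)
  (fun k => lip_alongM (lv 0 k) (lD k))).
apply: filterS (near_snd (f p0) (open_nbhs_nbhs (conj oU' U'p))) => q Uq.
by apply: esym; exact: derive2_sum_partial oU' Uq Cg.
Qed.

Lemma lip_along_derive2_mx_snd (a b : nat) (A : 'rV[R]_m -> 'M[R]_(a, b))
    (v : _ -> 'rV[R]_m) : Ck 2 U' A -> lip_along_mx f p0 v ->
  lip_along_mx f p0 (fun q => 'D_(v q) ('D_(v q) A) q.2).
Proof.
move=> CA lv i j.
have CAij : Ck 2 U' (fun p => A p i j) by exact: ((Ck_mx _ _ oU').1 CA).
apply: lip_along_eq (lip_along_derive2_snd CAij lv).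
apply: filterS (near_snd (f p0) (open_nbhs_nbhs (conj oU' U'p))) => q Uq.
by apply: esym; exact: derive2_mxE oU' Uq CA.
Qed.

End Derivatives.
End LipAlong.

(** * Compact balls and estimates of Euclidean sums by the sup norm *)

Lemma compact_closed_ball_rV (R : realType) (n : nat) (x : 'rV[R]_n) (r : R) :
  0 < r -> compact (closed_ball x r).
Proof.
move=> r0; apply: bounded_closed_compact; last exact: closed_ball_closed.
exists (`|x| + r); split; first exact: num_real.
move=> M hM y; rewrite closed_ballE // /closed_ball_ /= => xy.
rewrite (le_trans _ (ltW hM)) // -[y](subKr x) (le_trans (ler_normB _ _)) //.
by rewrite lerD2l.
Qed.

Lemma nbhs_closed_ball (R : realType) (V : normedModType R) (x : V) (r : R) :
  0 < r -> nbhs x (closed_ball x r).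
Proof.
by move=> r0; apply: filterS (nbhsx_ballx x r r0); exact: subset_closed_ball.
Qed.

Lemma sqnorm_ge0 (R : realType) (n : nat) (x : 'rV[R]_n) : 0 <= sqnorm x.
Proof. by apply: sumr_ge0 => l _; exact: sqr_ge0. Qed.

Lemma sqnorm0 (R : realType) (n : nat) : sqnorm (0 : 'rV[R]_n) = 0.
Proof. by rewrite /sqnorm big1 // => l _; rewrite mxE expr0n. Qed.

Lemma sqr_norm_le (R : realType) (n : nat) (x : 'rV[R]_n) :
  `|x| ^+ 2 <= sqnorm x.
Proof.
have [->|x0] := eqVneq `|x| 0; first by rewrite expr0n /= sqnorm_ge0.
have [[i l] xil] := mx_norm_neq0 x0.
have nx : `|x| = `|x i l| := xil.
rewrite nx (ord1 i).
rewrite -normrX ger0_norm ?sqr_ge0 // /sqnorm (bigD1 l) //= lerDl.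
by apply: sumr_ge0 => j _; exact: sqr_ge0.
Qed.

Lemma sqnorm_eq0 (R : realType) (n : nat) (x : 'rV[R]_n) : sqnorm x = 0 -> x = 0.
Proof.
move=> x0; apply/eqP; rewrite -normr_eq0 -sqrf_eq0 eq_le sqr_ge0 andbT -x0.
exact: sqr_norm_le.
Qed.

(** For [y = z - f p] and a transverse error [e], this and [sqnorm_le] bound the factor of [k] in
    [levi_penalized] by a multiple of the squared distance that is being penalized. *)
Lemma le_sum_mul_norm (R : realType) (n : nat) (C : R) (y e : 'rV[R]_n) :
  0 <= C -> (forall i l, `|e i l| <= C * `|y|) ->
  \sum_l y 0 l * e 0 l <= n%:R * C * sqnorm y.
Proof.
move=> C0 eC; apply: (@le_trans _ _ (\sum_(l < n) C * sqnorm y)).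
  apply: ler_sum => l _; apply: le_trans (ler_norm _) _; rewrite normrM.
  apply: (@le_trans _ _ (`|y| * (C * `|y|))).
    by rewrite ler_pM // ler_coord_norm.
  by rewrite mulrCA -expr2 ler_wpM2l // sqr_norm_le.
by rewrite sumr_const card_ord -mulrA mulr_natl.
Qed.

Lemma sqnorm_le (R : realType) (n : nat) (C : R) (y e : 'rV[R]_n) :
  0 <= C -> (forall i l, `|e i l| <= C * `|y|) ->
  sqnorm e <= n%:R * C ^+ 2 * sqnorm y.
Proof.
move=> C0 eC; apply: (@le_trans _ _ (\sum_(l < n) C ^+ 2 * sqnorm y)).
  apply: ler_sum => l _; apply: (@le_trans _ _ ((C * `|y|) ^+ 2)).
    by rewrite -real_normK ?num_real // lerXn2r // nnegrE // mulr_ge0.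
  by rewrite exprMn ler_wpM2l ?sqr_ge0 // sqr_norm_le.
by rewrite sumr_const card_ord -mulrA mulr_natl.
Qed.

Lemma levi_addc (R : realType) (n : nat) (U : set 'rV[R]_n)
    (J : 'rV[R]_n -> 'M[R]_n) (a : 'rV[R]_n) (f g : 'rV[R]_n -> R) (c : R)
    (p : 'rV[R]_n) : open U -> U p -> Ck 2 U f -> (forall x, g x = f x + c) ->
  levi J a g p = levi J a f p.
Proof.
move=> oU Up Cf gf.
have -> : g = (fun x => f x + cst c x) by apply/funext => x; exact: gf.
have D2 v := etrans (derive2D v v oU Up Cf (Ck_cst 2 c oU))
  (congr1 (fun x => _ + x) (derive2_cst c p v v)).
have dc v := diff_derivable (v := v) (Ck_differentiable Cf Up).
have D1 v := etrans (deriveD (dc v) (derivable_cst c p v))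
  (congr1 (fun x => _ + x) (derive_cst c p v)).
apply: etrans (congr2 +%R (congr2 +%R (D2 a) (D2 (a *m J p))) (D1 _)) _.
have addr000 (x y t : R) : x + 0 + (y + 0) + (t + 0) = x + y + t.
  by rewrite !addr0.
exact: addr000.
Qed.

Lemma leeBfin (R : realType) (x : \bar R) (a b : R) :
  (x - a%:E <= b%:E)%E = (x <= (b + a)%:E)%E.
Proof.
case: x => [r| |]; last by rewrite !leNye.
  by rewrite -EFinB !lee_fin lerBlDr.
by [].
Qed.

(** * Nonnegativity of the Levi form along a pseudo-holomorphic immersion *)

Section Core.
Context (R : realType) (m n : nat) (U' : set 'rV[R]_m) (U : set 'rV[R]_n)
  (f : 'rV[R]_m -> 'rV[R]_n) (J' : 'rV[R]_m -> 'M[R]_m)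
  (J : 'rV[R]_n -> 'M[R]_n) (w : 'rV[R]_n -> \bar R).
Context (oU' : open U') (oU : open U) (fU : forall p, U' p -> U (f p))
  (Cf : Ck 2 U' f) (CJ' : Ck 1 U' J') (CJ : Ck 2 U J)
  (J'J' : forall p, U' p -> J' p *m J' p = - 1%:M)
  (fJ : forall p, U' p -> J' p *m jacobian f p = jacobian f p *m J (f p)).
Context (woo : forall z, U z -> (w z < +oo)%E)
  (uw : forall z, U z -> usc_at w z).
Context (visc : forall z N psi, open N -> N z -> U z -> Ck 2 N psi ->
  (\forall x \near z, (w x <= (psi x)%:E)%E) -> w z = (psi z)%:E ->
  forall a, 0 <= levi J a psi z).

Let CJ1 : Ck 1 U J := CkS oU CJ.

(** At [z = f p] the vectors [A], [B] and [s] of [levi_penalized] all lie in the image of [Df], so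
    their transverse parts vanish. For [s] this is [levi_pseudoholomorphic]: the second derivatives
    [q A] and [q B] are exactly what separates [levi_dir J A] from the image of [levi_dir J' a]. *)
Lemma levi_on_graph (a p : 'rV[R]_m) (L : 'M[R]_(n, m)) : U' p ->
  jacobian f p *m L = 1%:M ->
  let A := a *m jacobian f p in
  let B := A *m J (f p) in
  let q v : 'rV[R]_n := 'D_(v *m L) ('D_(v *m L) f) p in
  [/\ A *m L = a, B = a *m J' p *m jacobian f p, B *m L = a *m J' p &
    levi_dir J A (f p) - q A - q B = levi_dir J' a p *m jacobian f p].
Proof.
move=> U'p DL A B q.
have df : differentiable f p := Ck_differentiable Cf U'p.
have AL : A *m L = a by rewrite /A -mulmxA DL mulmx1.
have eB : B = a *m J' p *m jacobian f p by rewrite /B /A -mulmxA -fJ // mulmxA.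
have BL : B *m L = a *m J' p by rewrite eB -mulmxA DL mulmx1.
split=> //.
have eA : 'D_a f p = A by rewrite deriveEjacobian.
have := levi_pseudoholomorphic a oU' oU U'p fU Cf CJ' CJ1 (J'J' U'p) fJ.
rewrite eA => <-; rewrite /levi /q AL BL.
rewrite (deriveEjacobian _ df).
have cancel (x y t : 'rV[R]_n) : x + y + t - x - y = t.
  by apply/matrixP => i j; rewrite !mxE; ring.
exact: cancel.
Qed.

Lemma levi_ge0_strict (phi : 'rV[R]_m -> R) (p0 a : 'rV[R]_m) :
  U' p0 -> row_free (jacobian f p0) -> Ck 2 U' phi ->
  w (f p0) = (phi p0)%:E ->
  (forall p, U' p -> p <> p0 -> (w (f p) < (phi p)%:E)%E) ->
  0 <= levi J' a phi p0.
Proof.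
move=> U'p0 free Cphi w0 wlt; rewrite leNgt; apply/negP => neg.
have cf : {for p0, continuous f} := Ck_continuous oU' Cf U'p0.
have Ufp0 : U (f p0) := fU U'p0.
have CD := Ck_jacobian oU' Cf.
have cD i j : {for p0, continuous (fun p => jacobian f p i j)}.
  exact: Ck_continuous oU' ((Ck_mx _ _ oU').1 CD i j) U'p0.
have [L [cL DL]] := continuous_right_inverse cD free.
pose A (q : 'rV[R]_n * 'rV[R]_m) := a *m jacobian f q.2.
pose B (q : 'rV[R]_n * 'rV[R]_m) := A q *m J q.1.
pose Q (v : _ -> 'rV[R]_n) (q : 'rV[R]_n * 'rV[R]_m) : 'rV[R]_n :=
  'D_(v q *m L q.2) ('D_(v q *m L q.2) f) q.2.
pose s (q : 'rV[R]_n * 'rV[R]_m) := levi_dir J (A q) q.1 - Q A q - Q B q.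
pose e1 (q : 'rV[R]_n * 'rV[R]_m) := B q - B q *m L q.2 *m jacobian f q.2.
pose e2 (q : 'rV[R]_n * 'rV[R]_m) := s q - s q *m L q.2 *m jacobian f q.2.
(* The part of [levi_penalized] that is free of [k], as a function of the contact point. It is
   continuous and equals [levi J' a phi p0] at [(f p0, p0)]. *)
pose G (q : 'rV[R]_n * 'rV[R]_m) : R :=
  'D_(A q *m L q.2) ('D_(A q *m L q.2) phi) q.2 +
  'D_(B q *m L q.2) ('D_(B q *m L q.2) phi) q.2 + 'D_(s q *m L q.2) phi q.2.
have lD : lip_along_mx f p0 (fun q => jacobian f q.2).
  exact: (lip_along_mx_snd f oU' U'p0 CD).
have lL : lip_along_mx f p0 (fun q => L q.2).
  by move=> i j; exact: (@lip_along_snd _ _ _ f p0 (fun p => L p i j)).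
have lA : lip_along_mx f p0 A.
  apply: (lip_along_mulmx cf) lD => i j; exact: lip_along_cst.
have lJ : lip_along_mx f p0 (fun q => J q.1).
  exact: (lip_along_mx_fst cf oU Ufp0 CJ1).
have lB : lip_along_mx f p0 B by exact: (lip_along_mulmx cf lA lJ).
have lQ v : lip_along_mx f p0 v -> lip_along_mx f p0 (Q v).
  move=> lv; apply: (lip_along_derive2_mx_snd cf oU' U'p0 Cf).
  exact: (lip_along_mulmx cf lv lL).
have ldir : lip_along_mx f p0 (fun q => levi_dir J (A q) q.1).
  have lBD := lip_along_derive_fst cf oU Ufp0 CJ lB.
  have lAD := lip_along_derive_fst cf oU Ufp0 CJ lA.
  exact: (lip_along_mxB cf (lip_along_mulmx cf lA lBD)
    (lip_along_mulmx cf lB lAD)).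
have ls : lip_along_mx f p0 s.
  exact: (lip_along_mxB cf (lip_along_mxB cf ldir (lQ _ lA)) (lQ _ lB)).
have lsL := lip_along_mulmx cf ls lL.
have lBL := lip_along_mulmx cf lB lL.
have lAL := lip_along_mulmx cf lA lL.
have le1 : lip_along_mx f p0 e1.
  exact: (lip_along_mxB cf lB (lip_along_mulmx cf lBL lD)).
have le2 : lip_along_mx f p0 e2.
  exact: (lip_along_mxB cf ls (lip_along_mulmx cf lsL lD)).
have [cG _] : lip_along f p0 G.
  apply: lip_alongD; first apply: lip_alongD.
  - exact: (lip_along_derive2_snd cf oU' U'p0 Cphi lAL).
  - exact: (lip_along_derive2_snd cf oU' U'p0 Cphi lBL).
  - exact: (lip_along_derive_snd cf oU' U'p0 (CkS oU' Cphi) lsL).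
have nU' : \forall p \near p0, U' p by exact: open_nbhs_nbhs.
have e10 : \forall p \near p0, e1 (f p, p) = 0.
  apply: filterS (filterI nU' DL) => p [U'p DLp].
  have [_ eB eBL _] := levi_on_graph a U'p DLp.
  by rewrite /e1 /B /A /= eBL eB subrr.
have e20 : \forall p \near p0, e2 (f p, p) = 0.
  apply: filterS (filterI nU' DL) => p [U'p DLp].
  have [_ _ _ es] := levi_on_graph a U'p DLp.
  have -> : e2 (f p, p) = levi_dir J' a p *m jacobian f p -
      levi_dir J' a p *m jacobian f p *m L p *m jacobian f p.
    exact: (congr1 (fun x => x - x *m L p *m jacobian f p) es).
  by rewrite -[_ *m jacobian f p *m L p]mulmxA DLp mulmx1 subrr.
have DL0 := nbhs_singleton DL.
have G0 : G (f p0, p0) = levi J' a phi p0.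
  have [eAL _ eBL es] := levi_on_graph a U'p0 DL0.
  have DLK (x : 'rV[R]_m) : x *m jacobian f p0 *m L p0 = x.
    by rewrite -mulmxA DL0 mulmx1.
  have esL := etrans (congr1 (mulmx^~ (L p0)) es) (DLK _).
  have ea := congr1 (fun v : 'rV[R]_m => 'D_v ('D_v phi) p0) eAL.
  have eb := congr1 (fun v : 'rV[R]_m => 'D_v ('D_v phi) p0) eBL.
  have ec := congr1 (fun v : 'rV[R]_m => 'D_v phi p0) esL.
  exact: (congr2 +%R (congr2 +%R ea eb) ec).
have [C1 C10 H1] := lip_along_mx_small le1 e10.
have [C2 C20 H2] := lip_along_mx_small le2 e20.
(* Half the absolute value of the supposedly negative Levi form: near [(f p0, p0)] one has
   [G < - eta], and the error must stay below [eta]. *)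
pose eta := - levi J' a phi p0 / 2.
have eta0 : 0 < eta by rewrite divr_gt0 // oppr_gt0.
have HG : \forall q \near (f p0, p0), G q < - eta.
  move/cvgrPdist_lt : cG => /(_ _ eta0); apply: filterS => q.
  by rewrite G0 ltr_norml => /andP[+ _]; rewrite /eta; lra.
have /nbhs_closedballP[r rU] : nbhs (f p0) U by exact: open_nbhs_nbhs.
have /nbhs_closedballP[r' rU'] : nbhs p0 U' by exact: open_nbhs_nbhs.
pose K := closed_ball (f p0) r%:num `*` closed_ball p0 r'%:num.
have cK : compact K.
  by apply: compact_setX; exact: compact_closed_ball_rV.
have nK : nbhs (f p0, p0) K.
  exists (closed_ball (f p0) r%:num, closed_ball p0 r'%:num) => //; split.
    exact: nbhs_closed_ball.
  exact: nbhs_closed_ball.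
pose P (q : 'rV[R]_n * 'rV[R]_m) : R := sqnorm (q.1 - f q.2).
pose h (q : 'rV[R]_n * 'rV[R]_m) : \bar R := (w q.1 - (phi q.2)%:E)%E.
(* Bounds the error by [M k P], the constants coming from [le_sum_mul_norm] and [sqnorm_le]. The
   added 1 makes [M] positive, so that the penalty can be required to be below [eta / M]. *)
pose M : R := 2 * (n%:R * C2 + n%:R * C1 ^+ 2) + 1.
have M0 : 0 < M.
  by rewrite ltr_wpDl // mulr_ge0 // addr_ge0 // mulr_ge0 // sqr_ge0.
(* Interior points of [K] are required because the maximum will be compared with all
   [(y, retraction y)] for [y] near [z]. *)
pose N q := [/\ K° q, G q < - eta, jacobian f q.2 *m L q.2 = 1%:M,
  forall i j, `|e1 q i j| <= C1 * `|q.1 - f q.2| &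
  forall i j, `|e2 q i j| <= C2 * `|q.1 - f q.2|].
have nN : nbhs (f p0, p0) N.
  have nDL := near_snd (f p0) DL.
  have nKi : nbhs (f p0, p0) K° by exact: nbhs_interior.
  by apply: filterS (filterI nKi (filterI HG (filterI nDL (filterI H1 H2))))
    => q [? [? [? [? ?]]]]; split.
have KU q : K q -> U q.1 /\ U' q.2 by move=> [/rU Uq /rU' U'q].
have Kp0 : K (f p0, p0) := nbhs_singleton nK.
have uh q : K q -> usc_at h q.
  move=> Kq; have [Uq U'q] := KU q Kq; apply: usc_atB.
    by move=> b /(uw Uq)/near_fst; apply.
  by move=> X /(Ck_continuous oU' Cphi U'q); exact: near_snd.
have hoo q : K q -> (h q < +oo)%E.
  move=> /KU[Uq _]; have := woo Uq; rewrite /h.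
  by case: (w q.1) => [x| |] // _; rewrite -EFinB ltry.
have cP q : K q -> {for q, continuous P}.
  move=> /KU[_ U'q]; apply: continuous_sum => l.
  have cfl : {for q.2, continuous (fun p => f p 0 l)}.
    exact: Ck_continuous oU' ((Ck_mx _ _ oU').1 Cf 0 l) U'q.
  have cl : {for q, continuous (fun x : 'rV[R]_n * 'rV[R]_m => x.1 0 l - f x.2 0 l)}.
    apply: cvgB; last by move=> X /cfl; exact: near_snd.
    by move=> X /(@coord_continuous R 1 n 0 l q.1); exact: near_fst.
  have -> : (fun y : 'rV[R]_n * 'rV[R]_m => (y.1 - f y.2) 0 l ^+ 2) =
      (fun y => (y.1 0 l - f y.2 0 l) * (y.1 0 l - f y.2 0 l)).
    by apply/funext => y; rewrite !mxE.
  exact: cvgM.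
have h0 : h (f p0, p0) = 0%E by rewrite /h /= w0 subee.
have P0 : P (f p0, p0) = 0 by rewrite /P subrr sqnorm0.
have hlt q : K q -> P q = 0 -> q <> (f p0, p0) -> (h q < 0)%E.
  case: q => z p Kq /sqnorm_eq0/subr0_eq /= -> zp.
  have [_ /= U'p] := KU _ Kq.
  rewrite /h /= lteBfin add0r; apply: wlt => // pp0.
  by apply: zp; rewrite /= in Kq *; rewrite pp0.
have [k [[z p] [k0 [Kzp [Kint HGq DLp He1 He2]] kP hkP max]]] :=
  penalized_max cK Kp0 nN (divr_gt0 eta0 M0) uh hoo cP
    (fun q => sqnorm_ge0 _) h0 P0 hlt.
have [Uz U'p] := KU _ Kzp; rewrite /= in Uz U'p DLp.
have [x wz] : exists x, w z = x%:E.
  move: hkP (woo Uz); rewrite /h /=.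
  by case: (w z) => [x| |] // _ _; exists x.
pose psi := penalized f phi p z (L p) k.
(* The maximum value need not be 0, so [psi] touches [w] at [z] only after adding this constant,
   which leaves the Levi form unchanged. *)
pose c := x - psi z.
pose psic : 'rV[R]_n -> R := fun y => psi y + c.
have psiz : psi z = phi p + k * P (z, p).
  by rewrite /psi /penalized /defect retractionz.
have oT : open (test_dom U' f p z (L p)) := @open_test_dom _ _ _ _ _ p z (L p) oU' Cf.
have Cpen : Ck 2 (test_dom U' f p z (L p)) psi := Ck_penalized p z (L p) k oU' Cf Cphi.
have tz := test_domz f z (L p) U'p.
have psiE y : psi y = phi (retraction f p z (L p) y) +
    k * P (y, retraction f p z (L p) y) by [].
have near_psi : \forall y \near z, (w y <= (psic y)%:E)%E.
  have cret : {for z, continuous (retraction f p z (L p))}.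
    have CR := Ck_retraction p z (L p) oU' Cf.
    exact: Ck_continuous oT CR (test_domz f z (L p) U'p).
  (* Restricting the two-variable maximum to the points [(y, retraction y)] turns it into contact
     from above in the single variable [y], since [retraction z = p]. *)
  have nKr : \forall y \near z, K (y, retraction f p z (L p) y).
    case: Kint => [[X Y] /= [nX nY] XY].
    have nY' : \forall y \near z, Y (retraction f p z (L p) y).
      by apply: cret; rewrite retractionz.
    by apply: filterS (filterI nX nY') => y [Xy Yy]; exact: (XY (y, _)).
  apply: filterS nKr => y Ky; have := max _ Ky.
  rewrite /h /= wz -!EFinB leeBfin leeBfin => /le_trans; apply.
  by rewrite lee_fin /psic /c psiz psiE; lra.
have wzpsi : w z = (psic z)%:E by rewrite wz /psic /c addrC subrK.
have Cpsi : Ck 2 (test_dom U' f p z (L p)) psic by exact: CkD oT Cpen (Ck_cst 2 c oT).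
have := visc oT tz Uz Cpsi near_psi wzpsi (A (z, p)).
rewrite (levi_addc J _ oT tz Cpen (fun=> erefl)).
have -> := levi_penalized z k oU' U'p Cf Cphi DLp J (A (z, p)).
(* [A = a Df(p)] is tangent to the image at [f p] even when [z] is not [f p]; among the two squared
   norms only that of [B], which involves [J z], is an error. *)
have eA : A (z, p) - A (z, p) *m L p *m jacobian f p = 0.
  by rewrite /A /= -[a *m _ *m _]mulmxA DLp mulmx1 subrr.
have G1 := le_sum_mul_norm C20 He2; have G2 := sqnorm_le C10 He1.
have combine (g s1 s2 s3 : R) : g < - eta -> s2 = 0 ->
    s1 <= n%:R * C2 * P (z, p) -> s3 <= n%:R * C1 ^+ 2 * P (z, p) ->
    0 <= g + k * (2 * (s1 + s2 + s3)) -> False.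
  move=> geta -> h1 h3; apply/negP; rewrite addr0 -ltNge.
  have : k * (2 * (s1 + s3)) <= M * (k * P (z, p)).
    apply: (@le_trans _ _ (k * (2 * (n%:R * C2 + n%:R * C1 ^+ 2) * P (z, p)))).
      by rewrite ler_wpM2l // -mulrA ler_wpM2l // mulrDl lerD.
    by rewrite mulrCA ler_wpM2r ?mulr_ge0 ?sqnorm_ge0 // /M lerDl.
  have : M * (k * P (z, p)) < eta by rewrite mulrC -ltr_pdivlMr.
  lra.
apply: combine HGq _ G1 G2; by rewrite eA sqnorm0.
Qed.

Lemma levi_ge0 (phi : 'rV[R]_m -> R) (p0 a : 'rV[R]_m) :
  U' p0 -> row_free (jacobian f p0) -> Ck 2 U' phi ->
  w (f p0) = (phi p0)%:E ->
  (forall p, U' p -> (w (f p) <= (phi p)%:E)%E) ->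
  0 <= levi J' a phi p0.
Proof.
move=> U'p0 free Cphi w0 wle.
(* Adding [|p - p0|^4] makes the maximum strict and keeps the 2-jet at [p0]. *)
pose g : 'rV[R]_m -> R := fun p => sqnorm (p - p0).
pose g2 : 'rV[R]_m -> R := fun p => g p ^+ 2.
pose phig : 'rV[R]_m -> R := fun p => phi p + g2 p.
have Cid : Ck 2 U' (fun p : 'rV[R]_m => p - p0).
  exact: CkB oU' (Ck_id 2 oU') (Ck_cst 2 p0 oU').
have Cg : Ck 2 U' g by exact: Ck_sqnorm oU' Cid.
have Cg2 : Ck 2 U' g2 by exact: Ck_eq oU' _ (Ck_mul oU' Cg Cg).
have g0 : g p0 = 0 by rewrite /g subrr sqnorm0.
have Dg v : 'D_v g p0 = 0.
  apply: etrans (derive_sqnorm v (Ck_differentiable Cid U'p0)) _.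
  by rewrite big1 ?mulr0 // => l _; rewrite subrr mxE mul0r.
have D2 v : 'D_v ('D_v phig) p0 = 'D_v ('D_v phi) p0.
  apply: etrans (derive2D v v oU' U'p0 Cphi Cg2) _.
  apply: etrans (congr1 (fun x => _ + x) (derive2_sqr v oU' U'p0 Cg)) _.
  have quartic (x y : R) : x + 2 * (g p0 * y + 'D_v g p0 ^+ 2) = x.
    by rewrite g0 Dg; ring.
  exact: quartic.
have D1 v : 'D_v phig p0 = 'D_v phi p0.
  have dphi := diff_derivable (v := v) (Ck_differentiable Cphi U'p0).
  have dg2 := diff_derivable (v := v) (Ck_differentiable Cg2 U'p0).
  apply: etrans (deriveD dphi dg2) _.
  apply: etrans (congr1 (fun x => _ + x)
    (derive_sqr v (Ck_differentiable Cg U'p0))) _.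
  by rewrite g0 mul0r mulr0 addr0.
have -> : levi J' a phi p0 = levi J' a phig p0.
  by apply: esym; exact: (congr2 +%R (congr2 +%R (D2 a) (D2 _)) (D1 _)).
have Cphig : Ck 2 U' phig by exact: CkD oU' Cphi Cg2.
have w0g : w (f p0) = (phig p0)%:E by rewrite w0 /phig /g2 g0 expr0n addr0.
have wlt p : U' p -> p <> p0 -> (w (f p) < (phig p)%:E)%E.
  move=> U'p pp0; apply: le_lt_trans (wle p U'p) _.
  rewrite lte_fin ltrDl lt_neqAle sqr_ge0 andbT eq_sym sqrf_eq0.
  by apply/eqP => /sqnorm_eq0/subr0_eq.
exact: levi_ge0_strict a U'p0 free Cphig w0g wlt.
Qed.

End Core.

(** * Transfer through charts *)

Lemma levi_eq (R : realType) (n : nat) (U : set 'rV[R]_n)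
    (J : 'rV[R]_n -> 'M[R]_n) (a p : 'rV[R]_n) (f g : 'rV[R]_n -> R) :
  open U -> U p -> (forall q, U q -> f q = g q) -> levi J a f p = levi J a g p.
Proof.
move=> oU Up fg.
have D1 v q : U q -> 'D_v f q = 'D_v g q.
  by move=> Uq; apply: near_eq_derive; exact: near_open oU Uq fg.
have D2 v : 'D_v ('D_v f) p = 'D_v ('D_v g) p.
  by apply: near_eq_derive; exact: near_open oU Up (D1 v).
exact: (congr2 +%R (congr2 +%R (D2 a) (D2 _)) (D1 _ _ Up)).
Qed.

Section Charts.
Context (R : realType) (X : topologicalType) (n : nat) (c : chart R X n).

Lemma cinv_cdom z : ccod c z -> cdom c (cinv c z).
Proof. by move=> [x cx <-]; rewrite cmapK. Qed.

Lemma cinvK z : ccod c z -> c (cinv c z) = z.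
Proof. by move=> [x cx <-]; rewrite cmapK. Qed.

Lemma cmap_continuous_at x : cdom c x -> {for x, continuous c}.
Proof.
move=> cx; have := @cmap_continuous _ _ _ c.
by rewrite (continuous_open_subspace _ (cdom_open c)); apply; rewrite inE.
Qed.

Lemma cinv_continuous_at z : ccod c z -> {for z, continuous (cinv c)}.
Proof.
move=> cz; have := @cinv_continuous _ _ _ c.
by rewrite (continuous_open_subspace _ (@ccod_open _ _ _ c)); apply; rewrite inE.
Qed.

Lemma open_cmap_image (O : set X) : open O -> open (c @` (cdom c `&` O)).
Proof.
move=> oO; rewrite openE => z [x [cx Ox] <-].
have ccx : ccod c (c x) by exists x.
have nO : nbhs (cinv c (c x)) O by rewrite cmapK //; exact: open_nbhs_nbhs.
have nO' : \forall z \near c x, O (cinv c z) by exact: cinv_continuous_at.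
have nc : \forall z \near c x, ccod c z.
  by apply: open_nbhs_nbhs; split=> //; exact: (@ccod_open _ _ _ c).
apply: filterS (filterI nO' nc) => y [Oy cy].
by exists (cinv c y); [split=> //; exact: cinv_cdom|exact: cinvK].
Qed.

Lemma open_cmap_preimage (N : set 'rV[R]_n) : open N ->
  open (cdom c `&` c @^-1` N).
Proof.
move=> oN; rewrite openE => x [cx Nx].
have nN : \forall y \near x, N (c y).
  by apply: cmap_continuous_at => //; exact: open_nbhs_nbhs.
by apply: filterI => //; apply: open_nbhs_nbhs; split=> //; exact: cdom_open.
Qed.

End Charts.

Lemma T10_real (R : realType) (n : nat) (j : 'M[R]_n) (a : 'rV[R]_n) :
  j *m j = - 1%:M ->
  T10 j (cmx a + 'i *: cmx (- (a *m j))) /\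
  map_mx (@complex.Re R) (cmx a + 'i *: cmx (- (a *m j))) = a.
Proof.
move=> jj; split; last by apply/matrixP => i k; rewrite mxE cmx_rectE.
rewrite /T10 mulmxDl -scalemxAl -!map_mxM mulNmx -mulmxA jj mulmxN mulmx1 opprK.
apply/matrixP => i k; have := sqrCi (Cx R); rewrite expr2 => ii.
rewrite [LHS]cmx_rectE [RHS]mxE cmx_rectE !mxE.
by rewrite -complexiE; simpc.
Qed.

Section Restriction.
Context (R : realType) (X : topologicalType) (n : nat)
  (M : smooth_manifold R X n) (J : almost_complex M) (u : X -> \bar R).
Context (pu : plurisubharmonic J u) (c : chart R X n) (ac : atlas M c).

Lemma usc_at_chart z : ccod c z -> usc_at (u \o cinv c) z.
Proof.
move=> cz a uza; have [_ uu _] := pu.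
have nO : nbhs (cinv c z) [set x | (u x < a%:E)%E].
  by apply: open_nbhs_nbhs; split; [exact: uu|].
exact: (cinv_continuous_at cz nO).
Qed.

(** The coordinate function [psi] is carried to the manifold as [psi \o c]. It is of class C^2 in
    every other chart through the smooth transition maps, and any real direction [a] is the real
    part of a vector of type (1,0). *)
Lemma plurisubharmonic_levi_ge0 (z : 'rV[R]_n) (N : set 'rV[R]_n)
    (psi : 'rV[R]_n -> R) : open N -> N z -> ccod c z -> Ck 2 N psi ->
  (\forall y \near z, (u (cinv c y) <= (psi y)%:E)%E) ->
  u (cinv c z) = (psi z)%:E -> forall a, 0 <= levi (J c) a psi z.
Proof.
move=> oN Nz cz Cpsi upsi uz a; have [_ _ visc] := pu.
pose x := cinv c z; have cx : cdom c x := cinv_cdom cz.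
have cxz : c x = z := cinvK cz.
have tf : test_function M u x (psi \o c).
  split.
  - exists (cdom c `&` c @^-1` N); split.
      split; first exact: open_cmap_preimage.
      by split=> //; rewrite /= cxz.
    move=> c2 ac2.
    have oD := @open_cmap_image _ _ _ c2 _ (cdom_open c).
    have oDN := @open_cmap_image _ _ _ c2 _ (@open_cmap_preimage _ _ _ c _ oN).
    have Ct := atlas_smooth ac2 ac 2.
    have sub : c2 @` (cdom c2 `&` (cdom c `&` c @^-1` N)) `<=`
        c2 @` (cdom c2 `&` cdom c).
      by apply: image_subset => y [c2y [cy _]].
    apply: (Ck_comp_real oDN oN _ (Ck_subset oD oDN sub Ct) Cpsi).
    by move=> _ [y [c2y [cy Ny]] <-] /=; rewrite cmapK.
  - have ncx : \forall y \near x, cdom c y.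
      by apply: open_nbhs_nbhs; split=> //; exact: cdom_open.
    have nu : \forall y \near x, (u (cinv c (c y)) <= (psi (c y))%:E)%E.
      have upsi' : \forall y \near c x, (u (cinv c y) <= (psi y)%:E)%E.
        by rewrite cxz.
      exact: (cmap_continuous_at cx upsi').
    apply: filterS (filterI ncx nu) => y [cy]; rewrite cmapK // => uy.
    by rewrite leeBfin add0r.
  - by rewrite /= /x cinvK // uz subee.
have Ccod : open (ccod c) := @ccod_open _ _ _ c.
have jj := acmx_sqr J ac cz.
have [TV ReV] := T10_real a jj.
have := visc x _ tf c ac cx; rewrite cxz => /(_ _ TV).
have oNc : open (N `&` ccod c) by exact: openI.
have Nc : (N `&` ccod c) z by [].
(* Outside the codomain of the chart [cinv] is arbitrary, so [psi] is recovered only there; this is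
   enough because the Levi form is local. *)
have eqpsi q : (N `&` ccod c) q -> psi q = ((psi \o c) \o cinv c) q.
  by move=> [_ cq]; rewrite /= cinvK.
have CN : Ck 2 (N `&` ccod c) psi by exact: Ck_subset oN oNc _ Cpsi.
have Cpsic : Ck 2 (N `&` ccod c) ((psi \o c) \o cinv c).
  exact: Ck_eq oNc eqpsi CN.
have CJ : Ck 1 (N `&` ccod c) (J c).
  exact: Ck_subset Ccod oNc _ (acmx_smooth J ac 1).
have -> := hessian_levi oNc Nc Cpsic CJ jj TV.
rewrite ReV -(levi_eq (J c) a oNc Nc eqpsi).
by rewrite ler0c.
Qed.

End Restriction.

Theorem theorem5p2 (R : realType) (X : topologicalType) (n : nat)
    (M : smooth_manifold R X n) (J : almost_complex M)
    (X' : set X) (m : nat)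
    (M' : smooth_manifold R X' m) (J' : almost_complex M')
    (u : X -> \bar R) :
  almost_complex_submanifold J J' ->
  plurisubharmonic J u ->
  plurisubharmonic J' (fun x' : X' => u (set_val x')).
Proof.
move=> [sM JJ'] pu; have [uoo uu _] := pu.
have cval : continuous (@set_val X X' : X' -> X).
  exact: (@initial_continuous X' X set_val).
split=> [x'|a|x' phi [[U0 [[oU0 U0x'] Cphi0]] uphi ux'] c' ac' cx' V TV].
- exact: uoo.
- exact: (@open_comp X' X set_val [set x | (u x < a%:E)%E] (fun y _ => cval y) (uu a)).
have [c ac cx] := atlas_cover M (set_val x').
have oW : open [set a : X' | cdom c (set_val a)].
  apply: (open_comp (f := @set_val X X')) => [y _|]; first exact: cval.
  exact: cdom_open.
have uphi' : nbhs x' [set y : X' | (u (set_val y) - (phi y)%:E <= 0)%E] := uphi.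
move: uphi'; rewrite nbhsE => -[V0 [oV0 V0x'] V0u].
(* A neighbourhood of [x'] on which [phi] is of class C^2, lies above [u], and one ambient chart [c]
   covers the submanifold. It makes the contact inequality hold on all of [U'], as [levi_ge0]
   requires. *)
pose O := U0 `&` (V0 `&` [set a : X' | cdom c (set_val a)]).
have oO : open O by apply: openI => //; exact: openI.
pose U' := c' @` (cdom c' `&` O).
have oU' : open U' := @open_cmap_image _ _ _ c' _ oO.
have U'p0 : U' (c' x') by exists x'.
have U'ccod p : U' p -> ccod c' p by move=> [y [cy _] <-]; exists y.
have U'incl p : U' p -> incl_dom c' c p.
  by move=> [y [cy [_ [_ cy']]] <-]; exists y.
have oincl : open (incl_dom c' c) := @open_cmap_image _ _ _ c' _ oW.
have occ : open (ccod c) := @ccod_open _ _ _ c.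
have occ' : open (ccod c') := @ccod_open _ _ _ c'.
have [Cincl free] := sM c' c ac' ac.
have oU0i : open (c' @` (cdom c' `&` U0)) := @open_cmap_image _ _ _ c' _ oU0.
have U'U0 : U' `<=` c' @` (cdom c' `&` U0).
  by apply: image_subset => y [cy [U0y _]].
have Cphi : Ck 2 U' (phi \o cinv c').
  exact: Ck_subset oU0i oU' U'U0 (Cphi0 c' ac').
have CJ' : Ck 1 U' (J' c') by exact: Ck_subset occ' oU' U'ccod (acmx_smooth J' ac' 1).
have J'J' p : U' p -> J' c' p *m J' c' p = - 1%:M.
  by move=> /U'ccod; exact: acmx_sqr.
(* The complex vector [V] now enters only through its real part, and both manifolds are described by
   coordinate data alone. *)
have -> := hessian_levi oU' U'p0 Cphi CJ' (J'J' _ U'p0) TV.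
rewrite ler0c.
have fU p : U' p -> ccod c (Defs.incl c' c p).
  move=> [y [cy [_ [_ cy']]] <-]; exists (set_val y) => //.
  by rewrite /Defs.incl cmapK.
have wf y : O y -> cdom c' y -> u (cinv c (Defs.incl c' c (c' y))) = u (set_val y).
  by move=> [_ [_ cy']] cy; rewrite /Defs.incl cmapK // cmapK.
apply: (@levi_ge0 R m n U' (ccod c) (Defs.incl c' c) (J' c') (J c) (u \o cinv c)) => //.
- exact: Ck_subset oincl oU' U'incl (Cincl 2%N).
- exact: (acmx_smooth J ac 2%N).
- by move=> p U'p; exact: (JJ' c' c p ac' ac (U'incl p U'p)).
- by move=> z _; exact: uoo.
- by move=> z cz; exact: (usc_at_chart pu cz).
- move=> z N psi oN Nz cz CN.
  exact: (plurisubharmonic_levi_ge0 pu ac oN Nz cz CN).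
- exact: free (U'incl _ U'p0).
- have Ox' : O x' by [].
  rewrite /= (wf _ Ox' cx') cmapK //; move: ux'.
  case: (u (set_val x')) => [r| |] // /eqP.
  by rewrite -EFinB eqe subr_eq0 => /eqP ->.
- move=> _ [y [cy Oy] <-] /=; rewrite (wf _ Oy cy) cmapK //.
  have [_ [V0y _]] := Oy; have := V0u y V0y.
  by rewrite /= leeBfin add0r.
Qed.
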